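(* Let $\Lambda$ be a row-finite $\mathbb{N}$-graph with no sources, let $B$ be a $C^{*}$-algebra, let $\pi: C^{*}(\Lambda) \rightarrow B$ be a *-homomorphism, and let $\beta: \mathbb{T}^{\omega} \rightarrow \mathrm{Aut}(B)$ be an action such that $\pi \circ \alpha_t = \beta_t \circ \pi$ for every $t \in \mathbb{T}^{\omega}$, where $\alpha$ is the gauge action on $C^*(\Lambda)$. Then $\pi$ is faithful (injective) if and only if $\pi(p_{v}) \neq 0$ for every $v \in \Lambda^0$.
   Context: $\mathbb{N}^{\mathbb{N}}_{0}$ is the monoid of sequences of nonnegative integers with only finitely many nonzero entries, with entrywise addition. An $\mathbb{N}$-graph $(\Lambda,d)$ is a countable small category $\Lambda$ with range and source maps $r,s$ ($\lambda\mu$ is defined when $s(\lambda)=r(\mu)$) and a functor $d:\Lambda\to\mathbb{N}^{\mathbb{N}}_{0}$ with the factorization property: whenever $d(\lambda)=m+n$ there are unique $\mu,\nu\in\Lambda$ with $\lambda=\mu\nu$, $d(\mu)=m$, $d(\nu)=n$. Put $\Lambda^n=d^{-1}(n)$; $\Lambda^0$ is identified with the objects. For $v\in\Lambda^0$, $v\Lambda^n=\{\lambda\in\Lambda^n: r(\lambda)=v\}$. $\Lambda$ is row-finite if every $v\Lambda^n$ is finite, and has no sources if every $v\Lambda^n$ is nonempty. $C^*(\Lambda)$ is the universal $C^*$-algebra generated by partial isometries $\{s_\lambda:\lambda\in\Lambda\}$ such that (CK1) $\{s_v:v\in\Lambda^0\}$ are mutually orthogonal projections; (CK2) $s_{\lambda}s_\mu=s_{\lambda\mu}$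 if $s(\lambda)=r(\mu)$ and $s_\lambda s_\mu=0$ otherwise; (CK3) $s_\lambda^*s_\lambda=s_{s(\lambda)}$; (CK4) $s_v=\sum_{\lambda\in v\Lambda^n}s_\lambda s_\lambda^*$ for all $v\in\Lambda^0$, $n\in\mathbb{N}^{\mathbb{N}}_{0}$. One writes $p_v=s_v$ for $v\in\Lambda^0$. $\mathbb{T}^\omega=\prod_{\mathbb{N}}\mathbb{T}$ with the product topology. The gauge action $\alpha:\mathbb{T}^\omega\to\mathrm{Aut}(C^*(\Lambda))$ is determined by $\alpha_t(s_\lambda)=t^{d(\lambda)}s_\lambda$, where $t^m=t_1^{m_1}t_2^{m_2}\cdots$ for $t=(t_1,t_2,\dots)$ and $m=(m_1,m_2,\dots)\in\mathbb{N}^{\mathbb{N}}_{0}$. *)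

(* Defs.v *)
From HB Require Import structures.
From mathcomp Require Import all_boot all_order all_algebra.
From mathcomp Require Import finmap complex.
From mathcomp Require Import all_classical all_reals all_analysis.

Set Implicit Arguments.
Unset Strict Implicit.
Unset Printing Implicit Defensive.

Import Order.TTheory GRing.Theory Num.Theory.
Import numFieldNormedType.Exports.

Local Open Scope classical_set_scope.
Local Open Scope ring_scope.

(** C*-algebras over the complex numbers R[i]. They are not assumed to be
    unital, so the product cannot be that of a MathComp ring. *)

HB.mixin Record isCStarAlgebra (R : realType) A
    of CompleteNormedModule R[i] A := {
  cmul : A -> A -> A;
  cstar : A -> A;
  cmulA : associative cmul;
  cmulDl : left_distributive cmul +%R;
  cmulDr : right_distributive cmul +%R;
  cmulZl : forall (c : R[i]) (a b : A), cmul (c *: a) b = c *: cmul a b;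
  cmulZr : forall (c : R[i]) (a b : A), cmul a (c *: b) = c *: cmul a b;
  cstarK : involutive cstar;
  cstarD : {morph cstar : a b / a + b};
  cstarZ : forall (c : R[i]) (a : A), cstar (c *: a) = c^* *: cstar a;
  cstarM : forall a b : A, cstar (cmul a b) = cmul (cstar b) (cstar a);
  norm_cmul : forall a b : A, `|cmul a b| <= `|a| * `|b|;
  norm_cstar_cmul : forall a : A, `|cmul (cstar a) a| = `|a| ^+ 2
}.

#[short(type="cstarAlgType")]
HB.structure Definition CStarAlgebra (R : realType) :=
  {A of CompleteNormedModule R[i] A & isCStarAlgebra R A}.

Notation "a ** b" := (cmul a b) (at level 40, left associativity) : ring_scope.

Section CStarNotions.
Context {R : realType}.

Definition star_hom (A B : cstarAlgType R) (f : {linear A -> B}) : Prop :=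
  {morph f : a b / a ** b} /\ {morph f : a / cstar a}.

Definition star_aut (A : cstarAlgType R) (f : {linear A -> A}) : Prop :=
  star_hom f /\ bijective f.

Definition projection (A : cstarAlgType R) (p : A) : Prop :=
  cstar p = p /\ p ** p = p.

Definition partial_isometry (A : cstarAlgType R) (a : A) : Prop :=
  a ** cstar a ** a = a.

Definition cstar_subalgebra (A : cstarAlgType R) (S : set A) : Prop :=
  [/\ S 0,
      forall (c : R[i]) a b, S a -> S b -> S (c *: a + b),
      forall a b, S a -> S b -> S (a ** b),
      forall a, S a -> S (cstar a)
    & closed S].

Definition cstar_generates (I : Type) (A : cstarAlgType R) (s : I -> A) : Prop :=
  forall S : set A, cstar_subalgebra S -> (forall i, S (s i)) -> S = setT.

End CStarNotions.

(** The monoid of finitely supported sequences of natural numbers. *)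

Definition multidegree : Type := {fsfun nat -> nat with 0%N}.

HB.instance Definition _ := Choice.on multidegree.

Section Multidegree.
Implicit Types m n p : multidegree.

Definition mdeg_add m n : multidegree :=
  [fsfun i in (finsupp m `|` finsupp n)%fset => (m i + n i)%N].

Lemma mdeg_addE m n i : mdeg_add m n i = (m i + n i)%N.
Proof.
rewrite fsfunE in_fsetU !mem_finsupp.
by case: (m i) => [|?] //; case: (n i).
Qed.

Fact mdeg_addA : associative mdeg_add.
Proof. by move=> m n p; apply/fsfunP => i; rewrite !mdeg_addE addnA. Qed.

Fact mdeg_addC : commutative mdeg_add.
Proof. by move=> m n; apply/fsfunP => i; rewrite !mdeg_addE addnC. Qed.

Fact mdeg_add0 : left_id [fsfun] mdeg_add.
Proof. by move=> m; apply/fsfunP => i; rewrite mdeg_addE fsfun0E. Qed.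

HB.instance Definition _ :=
  GRing.isNmodule.Build multidegree mdeg_addA mdeg_addC mdeg_add0.

End Multidegree.

(** N-graphs. As usual for small categories presented by their morphisms,
    [gcomp l m] is only meaningful when [gsrc l = grng m]: the axioms do not
    constrain the other values, which are irrelevant. *)

Record ngraph := NGraph {
  vertex : countType;
  gpath : countType;
  grng : gpath -> vertex;
  gsrc : gpath -> vertex;
  gid : vertex -> gpath;
  gcomp : gpath -> gpath -> gpath;
  gdeg : gpath -> multidegree;
  rng_id : forall v, grng (gid v) = v;
  src_id : forall v, gsrc (gid v) = v;
  rng_comp : forall l m, gsrc l = grng m -> grng (gcomp l m) = grng l;
  src_comp : forall l m, gsrc l = grng m -> gsrc (gcomp l m) = gsrc m;
  comp_idl : forall l, gcomp (gid (grng l)) l = l;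
  comp_idr : forall l, gcomp l (gid (gsrc l)) = l;
  compA : forall l m n, gsrc l = grng m -> gsrc m = grng n ->
    gcomp l (gcomp m n) = gcomp (gcomp l m) n;
  deg_id : forall v, gdeg (gid v) = 0;
  deg_comp : forall l m, gsrc l = grng m -> gdeg (gcomp l m) = gdeg l + gdeg m;
  factorization : forall (l : gpath) (m n : multidegree), gdeg l = m + n ->
    exists! mn : gpath * gpath,
      [/\ gsrc mn.1 = grng mn.2, l = gcomp mn.1 mn.2, gdeg mn.1 = m & gdeg mn.2 = n]
}.

Definition paths_from (L : ngraph) (v : vertex L) (n : multidegree) :
  set (gpath L) := [set l | grng l = v /\ gdeg l = n].

Definition row_finite (L : ngraph) : Prop :=
  forall (v : vertex L) n, finite_set (paths_from v n).

Definition no_sources (L : ngraph) : Prop :=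
  forall (v : vertex L) n, paths_from v n !=set0.

(** The projection p_v is [s (gid v)], as objects are identified with paths of
    degree 0. The sum in [CK4] is the intended one for row-finite graphs only:
    [\sum_(_ \in _)] is 0 when infinitely many terms are nonzero. *)

Record CK_family (R : realType) (L : ngraph) (A : cstarAlgType R)
    (s : gpath L -> A) : Prop := {
  CK_pi : forall l, partial_isometry (s l);
  CK1_proj : forall v, projection (s (gid v));
  CK1_orth : forall u v, u != v -> s (gid u) ** s (gid v) = 0;
  CK2_comp : forall l m, gsrc l = grng m -> s l ** s m = s (gcomp l m);
  CK2_zero : forall l m, gsrc l != grng m -> s l ** s m = 0;
  CK3 : forall l, cstar (s l) ** s l = s (gid (gsrc l));
  CK4 : forall v n,
    s (gid v) = \sum_(l \in paths_from v n) (s l ** cstar (s l))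
}.

(** [(A, s)] is a model of C^*(L), which is unique up to isomorphism. Uniqueness
    of the morphism f follows from generation. *)

Definition is_graph_algebra (R : realType) (L : ngraph) (A : cstarAlgType R)
    (s : gpath L -> A) : Prop :=
  [/\ CK_family s,
      cstar_generates s
    & forall (B : cstarAlgType R) (t : gpath L -> B), CK_family t ->
        exists2 f : {linear A -> B}, star_hom f & forall l, f (s l) = t l].

(** The circle group, with the topology induced by R[i]. *)

Definition circle (R : realType) : Type :=
  set_type [set z : R[i]^o | `|z| = 1].

HB.instance Definition _ (R : realType) := Topological.on (circle R).

Section Circle.
Context {R : realType}.
Implicit Types z w : circle R.

Definition circle_val z : R[i] := set_val z.

Fact circle_normP z : `|circle_val z| = 1.
Proof. exact: set_valP z. Qed.

Fact circle_val_inj : injective circle_val.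
Proof. exact: val_inj. Qed.

Definition mk_circle (z : R[i]) (z1 : `|z| = 1) : circle R :=
  exist _ (z : R[i]^o) (mem_set z1).

Fact circle_one_subproof : `|1 : R[i]| = 1.
Proof. exact: normr1. Qed.

Fact circle_mul_subproof z w : `|circle_val z * circle_val w| = 1.
Proof. by rewrite normrM !circle_normP mulr1. Qed.

Fact circle_inv_subproof z : `|(circle_val z)^-1| = 1.
Proof. by rewrite normfV circle_normP invr1. Qed.

Definition circle_one : circle R := mk_circle circle_one_subproof.
Definition circle_mul z w : circle R := mk_circle (circle_mul_subproof z w).
Definition circle_inv z : circle R := mk_circle (circle_inv_subproof z).

Fact circle_mulA : associative circle_mul.
Proof. by move=> x y z; apply: circle_val_inj; exact: mulrA. Qed.

Fact circle_mul1 : left_id circle_one circle_mul.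
Proof. by move=> x; apply: circle_val_inj; exact: mul1r. Qed.

Fact circle_mulr1 : right_id circle_one circle_mul.
Proof. by move=> x; apply: circle_val_inj; exact: mulr1. Qed.

Fact circle_neq0 z : circle_val z != 0.
Proof. by rewrite -normr_eq0 circle_normP oner_eq0. Qed.

Fact circle_mulV : left_inverse circle_one circle_inv circle_mul.
Proof. by move=> x; apply: circle_val_inj; exact: mulVf (circle_neq0 x). Qed.

Fact circle_mulrV : right_inverse circle_one circle_inv circle_mul.
Proof. by move=> x; apply: circle_val_inj; exact: mulfV (circle_neq0 x). Qed.

HB.instance Definition _ := isGroup.Build (circle R)
  circle_mulA circle_mul1 circle_mulr1 circle_mulV circle_mulrV.

End Circle.

(** The infinite-dimensional torus, with pointwise product and the product
    topology. *)

Definition torus (R : realType) : Type := {ptws nat -> circle R}.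

HB.instance Definition _ (R : realType) := Topological.on (torus R).

Section Torus.
Context {R : realType}.
Implicit Types t u : torus R.

Definition torus_one : torus R := fun=> 1%g.
Definition torus_mul t u : torus R := fun i => (t i * u i)%g.
Definition torus_inv t : torus R := fun i => (t i)^-1%g.

Fact torus_mulA : associative torus_mul.
Proof. by move=> x y z; apply/funext => i; exact: mulgA. Qed.

Fact torus_mul1 : left_id torus_one torus_mul.
Proof. by move=> x; apply/funext => i; exact: mul1g. Qed.

Fact torus_mulr1 : right_id torus_one torus_mul.
Proof. by move=> x; apply/funext => i; exact: mulg1. Qed.

Fact torus_mulV : left_inverse torus_one torus_inv torus_mul.
Proof. by move=> x; apply/funext => i; exact: mulVg. Qed.

Fact torus_mulrV : right_inverse torus_one torus_inv torus_mul.
Proof. by move=> x; apply/funext => i; exact: mulgV. Qed.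

HB.instance Definition _ := isGroup.Build (torus R)
  torus_mulA torus_mul1 torus_mulr1 torus_mulV torus_mulrV.

Definition torus_pow t (m : multidegree) : R[i] :=
  \prod_(i <- finsupp m) circle_val (t i) ^+ m i.

(** An action on a C*-algebra is, as usual, a strongly continuous homomorphism
    into the automorphism group. *)

Definition torus_action (A : cstarAlgType R) (b : torus R -> {linear A -> A}) :
    Prop :=
  [/\ forall t, star_aut (b t),
      forall a, b 1%g a = a,
      forall t u a, b (t * u)%g a = b t (b u a)
    & forall a, continuous (fun t => b t a)].

Definition gauge_action (L : ngraph) (A : cstarAlgType R) (s : gpath L -> A)
    (al : torus R -> {linear A -> A}) : Prop :=
  torus_action al /\ forall t l, al t (s l) = torus_pow t (gdeg l) *: s l.

End Torus.

(* Main.v *)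
(* Injectivity forces f (p_v) <> 0 because p_v <> 0 in C*(L): the universal
   property maps p_v to the projection onto the span of the infinite paths with
   range v, in the representation of L on l^2 of its infinite paths, and such
   paths exist since L has no sources.

   Conversely, let f (p_v) <> 0 for all v. Everything rests on one amplification
   trick: if x_0 = x, x_(k+1) = x_k^* x_k and |x_k| <= C q^k |f x_k| for all k,
   then |x|^(2^k) <= C q^k |f x|^(2^k), hence |x| <= |f x|. It is applied
   - to the span of the s_l s_m^* with l, m in a finite set of paths of one degree,
     where reading off the matrix entries s_l^* x s_m gives such an estimate; this
     makes f isometric on the core, spanned by the s_l s_m^* with d(l) = d(m);
   - then to one circle of the torus at a time: an element with at most N spectral
     components in one coordinate satisfies |x| <= N |f x|, since averaging over
     roots of unity bounds each component, and N only doubles when x is replaced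
     by x^* x.
   So f is isometric on the span of all the s_l s_m^*, which is dense. No integral
   over the torus, no conditional expectation and no order on A are needed; the
   C*-algebraic input is that star-homomorphisms are contractive and that
   projections whose sum is a projection are orthogonal. *)
From HB Require Import structures.
From mathcomp Require Import all_boot all_order all_algebra.
From mathcomp Require Import cyclic separable cyclotomic.
From mathcomp Require Import finmap complex.
From mathcomp Require Import all_classical all_reals all_analysis.
From mathcomp Require Import zify ring lra.
From mathcomp Require summability.
Require Import Defs.

Set Implicit Arguments.
Unset Strict Implicit.
Unset Printing Implicit Defensive.

Import Order.TTheory GRing.Theory Num.Theory.
Import numFieldNormedType.Exports.

Local Open Scope classical_set_scope.
Local Open Scope ring_scope.

(** * Norms and C*-algebras *)

(** Two obstacles shape the proof. [CK4] states that range projections sum to a projection without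
    saying that the summands are orthogonal; with no order on [A], this is extracted from the fact
    that a projection is an extreme point of the unit ball of its corner. And the torus is
    infinite-dimensional, but degrees are finitely supported, so each element of the span of the s_l
    s_m^* sees only finitely many circles, which can be treated by induction. The amplification
    trick tolerates very crude estimates, because |x_k| is exactly |x|^(2^k) by the C*-identity:
    counting matrix entries or spectral components costs a factor at most exponential in k, which
    disappears under 2^k-th roots. *)

Definition nrm (R : realType) (V : normedModType R[i]) (x : V) : R :=
  complex.Re `|x|.

Section RealNorm.
Context {R : realType}.

Lemma ge0_ReK (z : R[i]) : 0 <= z -> (complex.Re z)%:C%C = z.
Proof. by move=> z0; apply: RRe_real; exact: ger0_real. Qed.

Lemma Re_le (z w : R[i]) : z <= w -> complex.Re z <= complex.Re w.
Proof. by rewrite lecE => /andP[]. Qed.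

Context {V : normedModType R[i]}.
Implicit Types x y : V.

(** The norm of a module over [R[i]] is complex-valued; inequalities are moved to real values, where
    [lra] and [nra] apply. *)
Lemma nrmE x : `|x| = (nrm x)%:C%C.
Proof. by rewrite /nrm ge0_ReK. Qed.

Lemma nrm_ge0 x : 0 <= nrm x.
Proof. by rewrite -ler0c -nrmE. Qed.

Lemma nrmD x y : nrm (x + y) <= nrm x + nrm y.
Proof. by rewrite -lecR rmorphD /= -!nrmE ler_normD. Qed.

Lemma nrmN x : nrm (- x) = nrm x.
Proof. by rewrite /nrm normrN. Qed.

Lemma nrmB x y : nrm (x - y) <= nrm x + nrm y.
Proof. by rewrite -(nrmN y) nrmD. Qed.

Lemma nrm0 : nrm (0 : V) = 0.
Proof. by rewrite /nrm normr0. Qed.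

Lemma nrm_eq0 x : nrm x = 0 -> x = 0.
Proof. by move=> x0; apply: normr0_eq0; rewrite nrmE x0. Qed.

Lemma nrmZ (c : R[i]) x : nrm (c *: x) = complex.Re `|c| * nrm x.
Proof.
by apply: complexI; rewrite rmorphM /= -nrmE normrZ ge0_ReK // -nrmE.
Qed.

Lemma nrmZ1 (c : R[i]) x : `|c| = 1 -> nrm (c *: x) = nrm x.
Proof. by move=> c1; rewrite nrmZ c1 mul1r. Qed.

Lemma nrmZR (r : R) x : 0 <= r -> nrm (r%:C%C *: x) = r * nrm x.
Proof. by move=> r0; rewrite nrmZ ger0_norm ?ler0c. Qed.

Lemma nrmMn n x : nrm (x *+ n) = n%:R * nrm x.
Proof. by apply: complexI; rewrite rmorphM /= -!nrmE normrMn rmorph_nat mulr_natl. Qed.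

Lemma nrm_sum (I : Type) (r : seq I) (P : pred I) (F : I -> V) :
  nrm (\sum_(i <- r | P i) F i) <= \sum_(i <- r | P i) nrm (F i).
Proof.
elim/big_ind2: _ => [|x a y b xa yb|//]; first by rewrite nrm0.
exact: le_trans (nrmD _ _) (lerD xa yb).
Qed.

End RealNorm.

Section CStarAlgebraBasics.
Context {R : realType} {A : cstarAlgType R}.
Implicit Types a b : A.

Lemma cmul0l b : 0 ** b = 0 :> A.
Proof. by have := cmulZl 0 0 b; rewrite !scale0r. Qed.

Lemma cmul0r a : a ** 0 = 0 :> A.
Proof. by have := cmulZr 0 a 0; rewrite !scale0r. Qed.

Lemma cmulNl a b : (- a) ** b = - (a ** b).
Proof. by rewrite -scaleN1r cmulZl scaleN1r. Qed.

Lemma cmulNr a b : a ** (- b) = - (a ** b).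
Proof. by rewrite -scaleN1r cmulZr scaleN1r. Qed.

Lemma cmulBl a b c : (a - b) ** c = a ** c - b ** c.
Proof. by rewrite cmulDl cmulNl. Qed.

Lemma cmulBr a b c : a ** (b - c) = a ** b - a ** c.
Proof. by rewrite cmulDr cmulNr. Qed.

Lemma cmul_suml (I : Type) (r : seq I) (P : pred I) (F : I -> A) b :
  (\sum_(i <- r | P i) F i) ** b = \sum_(i <- r | P i) F i ** b.
Proof. exact: (big_morph (cmul^~ b) (fun x y => cmulDl x y b) (cmul0l b)). Qed.

Lemma cmul_sumr (I : Type) (r : seq I) (P : pred I) (F : I -> A) a :
  a ** (\sum_(i <- r | P i) F i) = \sum_(i <- r | P i) a ** F i.
Proof. exact: (big_morph (cmul a) (cmulDr a) (cmul0r a)). Qed.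

Lemma cstar0 : cstar 0 = 0 :> A.
Proof. by have := cstarZ 0 (0 : A); rewrite conjC0 !scale0r. Qed.

Lemma cstarN a : cstar (- a) = - cstar a.
Proof. by rewrite -scaleN1r cstarZ rmorphN rmorph1 scaleN1r. Qed.

Lemma cstarB a b : cstar (a - b) = cstar a - cstar b.
Proof. by rewrite cstarD cstarN. Qed.

Lemma cstar_sum (I : Type) (r : seq I) (P : pred I) (F : I -> A) :
  cstar (\sum_(i <- r | P i) F i) = \sum_(i <- r | P i) cstar (F i).
Proof. exact: (big_morph _ (@cstarD _ A) cstar0). Qed.

Lemma nrmM a b : nrm (a ** b) <= nrm a * nrm b.
Proof. by rewrite -lecR rmorphM /= -!nrmE norm_cmul. Qed.

Lemma nrm_cstar_cmul a : nrm (cstar a ** a) = nrm a ^+ 2.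
Proof. by apply: complexI; rewrite rmorphXn /= -!nrmE norm_cstar_cmul. Qed.

Lemma cstar_cmul_eq0 a : cstar a ** a = 0 -> a = 0.
Proof.
move=> aa; apply/nrm_eq0/eqP; rewrite -sqrf_eq0.
by rewrite -nrm_cstar_cmul aa nrm0.
Qed.

Lemma nrm_cstar a : nrm (cstar a) = nrm a.
Proof.
have le_star b : nrm b <= nrm (cstar b).
  have [->|b0] := eqVneq (nrm b) 0; first exact: nrm_ge0.
  have b_gt0 : 0 < nrm b by rewrite lt_def b0 nrm_ge0.
  by rewrite -(ler_pM2r b_gt0) -expr2 -nrm_cstar_cmul nrmM.
by apply/eqP; rewrite eq_le le_star andbT -{2}(cstarK a) le_star.
Qed.

Lemma nrm_self_adjoint a : cstar a = a -> nrm (a ** a) = nrm a ^+ 2.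
Proof. by move=> aE; rewrite -{1}aE nrm_cstar_cmul. Qed.

Lemma nrm_projection (p : A) : projection p -> p <> 0 -> nrm p = 1.
Proof.
move=> [pE pp] p0; have := nrm_self_adjoint pE; rewrite pp.
have p_neq0 : nrm p != 0 by apply/eqP => /nrm_eq0.
by move=> /esym /eqP; rewrite expr2 -[X in _ == X]mulr1 (inj_eq (mulfI p_neq0)) => /eqP.
Qed.

Lemma nrm_projection_le1 (p : A) : projection p -> nrm p <= 1.
Proof.
move=> pP; have [->|p0] := eqVneq p 0; first by rewrite nrm0.
by rewrite nrm_projection //; apply/eqP.
Qed.

Fixpoint sq_iter (x : A) (k : nat) : A :=
  if k is k'.+1 then cstar (sq_iter x k') ** sq_iter x k' else x.

Lemma nrm_sq_iter x k : nrm (sq_iter x k) = nrm x ^+ (2 ^ k).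
Proof. by elim: k => [|k IHk] //=; rewrite nrm_cstar_cmul IHk -exprM expnSr. Qed.

End CStarAlgebraBasics.

Lemma sq_iter_hom {R : realType} {A B : cstarAlgType R} (f : {linear A -> B}) x k :
  star_hom f -> f (sq_iter x k) = sq_iter (f x) k.
Proof. by case=> fM fS; elim: k => [|k IHk] //=; rewrite fM fS IHk. Qed.

Lemma bernoulli_ineq {R : realType} (r : R) n : 0 <= r -> 1 + n%:R * r <= (1 + r) ^+ n.
Proof.
move=> r0; elim: n => [|n IHn]; first by rewrite mul0r addr0 expr0.
rewrite exprSr; apply: le_trans (ler_wpM2r _ IHn); last by lra.
have : 0 <= n%:R * r * r by rewrite !mulr_ge0.
rewrite -natr1; lra.
Qed.

(* The doubly exponential growth of [(a / b) ^+ (2 ^ k)] beats [C * q ^+ k]. *)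
Lemma le_of_pow2_le {R : realType} (a b C : R) (q : nat) : 0 <= a -> 0 <= b ->
  (forall k, a ^+ (2 ^ k) <= C * q%:R ^+ k * b ^+ (2 ^ k)) -> a <= b.
Proof.
move=> a0 b0 H; rewrite leNgt; apply/negP => ba.
have [b00|bn0] := eqVneq b 0.
  have := H 0; rewrite expn0 !expr1 b00 mulr0 => aM.
  by move: ba; rewrite b00 ltNge aM.
have bgt0 : 0 < b by rewrite lt_def bn0.
pose r := a / b.
have r1 : 1 < r by rewrite ltr_pdivlMr // mul1r.
have {}H k : r ^+ (2 ^ k) <= C * q%:R ^+ k.
  by rewrite expr_div_n ler_pdivrMr ?exprn_gt0.
have big (t x : R) : 1 < t -> exists n, x < t ^+ n.
  move=> t1; pose n := Num.trunc (`|x| / (t - 1)); exists n.+1.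
  have t0 : 0 < t - 1 by rewrite subr_gt0.
  have := bernoulli_ineq n.+1 (ltW t0).
  have -> : 1 + (t - 1) = t by lra.
  apply: lt_le_trans; have := truncnS_gt (`|x| / (t - 1)).
  rewrite ltr_pdivrMr // => xn; have := ler_norm x; rewrite -/n in xn; lra.
(* With T = r^(2^n) >= 2q + 2, the left side at n + i is T^(2^i) >= (2q + 2)^i. Once 2^i > C q^n,
   the right side C q^n q^i is smaller; the summand 2 keeps this strict and T >= 1 even for q =
   0. *)
have [n nP] := big r (2 * q%:R + 2) r1.
pose T := r ^+ (2 ^ n).
have T_big : 2 * q%:R + 2 <= T.
  apply: le_trans (ltW nP) _; rewrite ler_weXn2l ?(ltW r1) //.
  exact/ltnW/ltn_expl.
have [i iP] := big 2 (C * q%:R ^+ n) (ltr1n _ 2).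
have q0 : 0 <= q%:R :> R by [].
have := H (n + i)%N; rewrite expnD exprM -/T exprD mulrA leNgt => /negP; apply.
apply: (@lt_le_trans _ _ ((2 * q%:R + 2) ^+ i)); last first.
  apply: le_trans (_ : T ^+ i <= _); first by rewrite lerXn2r ?nnegrE //; lra.
  by rewrite ler_weXn2l ?(ltnW (ltn_expl _ _)) //; lra.
case: i iP => [|i]; first by rewrite !expr0 mulr1.
move=> iP; apply: (@le_lt_trans _ _ (2 ^+ i.+1 * q%:R ^+ i.+1)).
  by rewrite ler_wpM2r ?exprn_ge0 // ltW.
rewrite -exprMn ltrXn2r //; nra.
Qed.

(** * Contractivity of star-homomorphisms *)

(** Stated for any subadditive [N] because it serves [nrm], [hnorm] and the absolute value of
    reals. *)
Lemma geometric_telescope {R : realType} {V : zmodType} (N : V -> R) (u : nat -> V) :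
  N 0 = 0 -> (forall x y, N (x + y) <= N x + N y) ->
  (forall n, N (u n.+1 - u n) <= 2^-1 ^+ n) ->
  forall n m, (n <= m)%N -> N (u m - u n) <= 2 * 2^-1 ^+ n.
Proof.
move=> N0 ND u_step n m /subnKC <-; set k := (m - n)%N.
(* The induction needs the exact partial sum of the geometric series. *)
apply: (@le_trans _ _ (2 * 2^-1 ^+ n - 2 * 2^-1 ^+ (n + k))).
  elim: k => [|k IHk]; first by rewrite addn0 !subrr N0.
  rewrite addnS -[u _.+1](subrK (u (n + k)%N)) -addrA.
  apply: le_trans (ND _ _) _; apply: le_trans (lerD (u_step _) IHk) _.
  rewrite [2^-1 ^+ (n + k).+1]exprS; lra.
have : 0 <= 2^-1 ^+ (n + k) :> R by rewrite exprn_ge0 // invr_ge0.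
lra.
Qed.

Section GeometricLimits.
Context {R : realType} {V : completeNormedModType R[i]}.

Lemma half_exp_small (e : R) : 0 < e -> exists n, 2^-1 ^+ n < e.
Proof.
move=> e0; have := @cvg_expr R 2^-1; rewrite ger0_norm ?invr_ge0 //.
rewrite invf_lt1 ?ltr1n // => /(_ isT) /cvgrPdist_lt /(_ e e0) [n _ nP].
by exists n; have /= := nP n (leqnn n); rewrite sub0r normrN ger0_norm.
Qed.

Lemma le0_of_half_exp (d C : R) : (forall n, d <= C * 2^-1 ^+ n) -> d <= 0.
Proof.
move=> dC; rewrite leNgt; apply/negP => d0.
have C0 : 0 < C by have := dC 0; rewrite expr0 mulr1; lra.
have [n nP] := half_exp_small (divr_gt0 d0 C0).
by have := dC n; rewrite leNgt -ltr_pdivlMl // mulrC nP.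
Qed.

(** Stands in for continuity: an identity passes to a limit once its defect is bounded through
    approximants with error of order 2^-n. *)
Lemma le_half_exp_eq0 (W : normedModType R[i]) (x : W) (C : R) :
  (forall n, nrm x <= C * 2^-1 ^+ n) -> x = 0.
Proof.
move=> /le0_of_half_exp x0; apply: nrm_eq0; apply/eqP.
by rewrite eq_le nrm_ge0 x0.
Qed.

Lemma geometric_cauchy_lim (u : nat -> V) :
  (forall n, nrm (u n.+1 - u n) <= 2^-1 ^+ n) ->
  exists l, forall n, nrm (l - u n) <= 2 * 2^-1 ^+ n.
Proof.
move=> u_step.
have u_dist := geometric_telescope (nrm0 (V := V)) (@nrmD _ V) u_step.
have /cauchy_cvg /cvg_ex [l ul] : cauchy (u @ \oo).
  apply: cauchy_exP => e e0.
  have eE : e = (complex.Re e)%:C%C by rewrite ge0_ReK // ltW.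
  have [|n nP] := @half_exp_small (complex.Re e / 2).
    by apply: divr_gt0 => //; rewrite -ltcR -eE.
  exists (u n), n => // m /= nm; rewrite -ball_normE /= distrC nrmE eE ltcR.
  by apply: le_lt_trans (u_dist _ _ nm) _; lra.
exists l => n; apply/ler_addgt0Pr => e e0.
have e0' : 0 < e%:C%C :> R[i] by rewrite -[0](rmorph0 (real_complex R)) ltcR.
have /cvgrPdist_lt /(_ _ e0') [m _ mP] := ul.
have := mP (maxn n m) (leq_maxr _ _); rewrite /= nrmE ltcR => /ltW lm.
rewrite -[l](subrK (u (maxn n m))) -addrA addrC.
by apply: le_trans (nrmD _ _) (lerD (u_dist _ _ (leq_maxl _ _)) lm).
Qed.

End GeometricLimits.

Section Contractivity.
Context {R : realType}.

Local Notation half := ((2^-1 : R)%:C%C : R[i]).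

Lemma half_ge0 : 0 <= half.
Proof. by rewrite -[0](rmorph0 (real_complex R)) lecR invr_ge0. Qed.

Lemma half2 : half + half = 1.
Proof. by rewrite -rmorphD /= (_ : 2^-1 + 2^-1 = 1 :> R); last by lra. Qed.

Lemma half_conj : half^* = half.
Proof. exact: geC0_conj half_ge0. Qed.

Lemma nrm_half (V : normedModType R[i]) (x : V) : nrm (half *: x) = 2^-1 * nrm x.
Proof. by rewrite nrmZR ?invr_ge0. Qed.

Lemma half_double (V : lmodType R[i]) (x : V) : half *: (x + x) = x.
Proof. by rewrite scalerDr -scalerDl half2 scale1r. Qed.

(* [1 - g] is the square root of [1 - h^2]. *)
Lemma one_sub_sqrt (A : cstarAlgType R) (h : A) :
  cstar h = h -> nrm (h ** h) <= 3 / 4 ->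
  exists g, [/\ cstar g = g, g ** h = h ** g & g + g = h ** h + g ** g].
Proof.
(* A fixed point g of [F] satisfies (1 - g)^2 = 1 - h^2. The bound 3/4 makes the ball of radius 1/2
   invariant, as (3/4 + 1/4)/2 = 1/2, and on it [F] halves distances. *)
move=> hE h_small; pose F (g : A) := half *: (h ** h + g ** g).
pose u n := iter n F 0.
have uS n : u n.+1 = F (u n) by [].
have u_nrm n : nrm (u n) <= 2^-1.
  elim: n => [|n IHn]; first by rewrite nrm0 invr_ge0.
  rewrite uS nrm_half; have := nrmD (h ** h) (u n ** u n).
  have := nrmM (u n) (u n); have := nrm_ge0 (u n); nra.
have u_star n : cstar (u n) = u n.
  elim: n => [|n IHn]; first exact: cstar0.
  by rewrite uS cstarZ half_conj cstarD !cstarM hE IHn.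
have u_comm n : u n ** h = h ** u n.
  elim: n => [|n IHn]; first by rewrite cmul0l cmul0r.
  rewrite uS cmulZl cmulZr cmulDl cmulDr; congr (_ *: (_ + _)).
    by rewrite cmulA.
  by rewrite -cmulA IHn cmulA IHn cmulA.
have sqB (a b : A) : a ** a - b ** b = (a - b) ** a + b ** (a - b).
  by rewrite cmulBl cmulBr addrA subrK.
have u_step n : nrm (u n.+1 - u n) <= 2^-1 ^+ n.
  elim: n => [|n IHn].
    by rewrite subr0 expr0; apply: le_trans (u_nrm _) _; lra.
  rewrite uS [u n.+1 in X in _ - X]uS -scalerBr nrm_half exprS.
  rewrite ler_wpM2l ?invr_ge0 // opprD addrACA subrr add0r sqB.
  apply: le_trans (nrmD _ _) _; apply: le_trans (lerD (nrmM _ _) (nrmM _ _)) _.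
  have := u_nrm n; have := u_nrm n.+1; have := nrm_ge0 (u n.+1 - u n).
  nra.
have [g gP] := geometric_cauchy_lim u_step.
have p0 n : 0 <= 2^-1 ^+ n :> R by rewrite exprn_ge0 ?invr_ge0.
exists g; split.
- apply/eqP; rewrite -subr_eq0; apply/eqP; apply: (le_half_exp_eq0 (C := 4)) => n.
  have -> : cstar g - g = cstar (g - u n) - (g - u n).
    by rewrite cstarB u_star opprB addrA subrK.
  by apply: le_trans (nrmB _ _) _; rewrite nrm_cstar; have := gP n; lra.
- apply/eqP; rewrite -subr_eq0; apply/eqP.
  apply: (le_half_exp_eq0 (C := 4 * nrm h)) => n.
  have -> : g ** h - h ** g = (g - u n) ** h - h ** (g - u n).
    by rewrite cmulBl cmulBr u_comm opprB addrA subrK.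
  apply: le_trans (nrmB _ _) _; apply: le_trans (lerD (nrmM _ _) (nrmM _ _)) _.
  have := gP n; have := nrm_ge0 h; have := p0 n; nra.
have gF : g = F g.
  apply/eqP; rewrite -subr_eq0; apply/eqP.
  apply: (le_half_exp_eq0 (C := 3 + nrm g)) => n.
  have -> : g - F g = (g - u n.+1) - half *: (g ** g - u n ** u n).
    rewrite uS /F; set b := u n ** u n; rewrite !scalerDr scalerN.
    set c := half *: b; set d := half *: _; set e := half *: _.
    by rewrite opprB !opprD !addrA subrK.
  apply: le_trans (nrmB _ _) _; rewrite nrm_half sqB.
  have := nrmD ((g - u n) ** g) (u n ** (g - u n)).
  have := nrmM (g - u n) g; have := nrmM (u n) (g - u n).
  have := gP n; have := gP n.+1; rewrite exprS; have := u_nrm n; have := p0 n.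
  have := nrm_ge0 g; have := nrm_ge0 (g - u n); have := nrm_ge0 (u n); nra.
by rewrite {1 2}gF -scalerDr half_double.
Qed.

Context {A B : cstarAlgType R} (f : {linear A -> B}) (fP : star_hom f).

(* [1 - w] is a unitary of which [h] is, up to sign, the imaginary part. *)
Lemma star_hom_bounded (h : A) : cstar h = h -> nrm (f h) <= 4 * nrm h.
Proof.
have small (k : A) : cstar k = k -> nrm (k ** k) <= 3 / 4 -> nrm (f k) <= 2.
  move=> kE k_small; have [g [gE gk gg]] := one_sub_sqrt kE k_small.
  pose w := g + 'i *: k.
  have wE : cstar w = g - 'i *: k by rewrite cstarD cstarZ conjCi gE kE scaleNr.
  (* Unitarity of 1 - w written without a unit. [f] preserves the relation, which gives |f w|^2 <= 2
     |f w|. *)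
  have ww : cstar w ** w = cstar w + w.
    rewrite wE cmulDr !cmulBl !cmulZl !cmulZr scalerA -expr2 sqrCi scaleN1r gk opprK.
    by rewrite addrA subrK addrC -gg /w addrACA addNr addr0.
  have fw : nrm (f w) <= 2.
    have := nrm_cstar_cmul (f w); rewrite -fP.2 -fP.1 ww linearD fP.2.
    have := nrmD (cstar (f w)) (f w); rewrite nrm_cstar; have := nrm_ge0 (f w); nra.
  have kw : 'i *: k = half *: (w - cstar w).
    by rewrite wE /w opprD opprK addrACA subrr add0r half_double.
  have fik : f ('i *: k) = 'i *: f k by rewrite linearZ.
  rewrite -(nrmZ1 (f k) (normCi _)) -fik kw linearZ /= nrm_half linearB fP.2.
  have := nrmB (f w) (cstar (f w)); rewrite nrm_cstar; lra.
move=> hE; have [h0|h0] := eqVneq (nrm h) 0.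
  by rewrite (nrm_eq0 h0) linear0 !nrm0 mulr0.
have h_gt0 : 0 < nrm h by rewrite lt_def h0 nrm_ge0.
(* Rescaling to norm 1/2 puts the square within the bound 3/4; the resulting bound 2 scales back to
   4 |h|. *)
pose c : R := (2 * nrm h)^-1.
have c0 : 0 < c by rewrite invr_gt0 mulr_gt0.
have cc : c * nrm h = 2^-1 by rewrite /c; field.
have c_conj : (c%:C%C : R[i])^* = c%:C%C.
  by rewrite geC0_conj // -[0](rmorph0 (real_complex R)) lecR ltW.
pose k := c%:C%C *: h.
have kE : cstar k = k by rewrite cstarZ hE c_conj.
have kn : nrm k = 2^-1 by rewrite nrmZR ?ltW.
have fk : nrm (f k) <= 2 by apply: small => //; rewrite nrm_self_adjoint // kn; lra.
rewrite linearZ /= nrmZR in fk; last exact: ltW.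
have : c * nrm (f h) <= c * (4 * nrm h) by rewrite mulrCA cc; lra.
by rewrite ler_pM2l.
Qed.

(** The constant 4 is removed by amplification, since all iterates of [cstar a ** a] are
    self-adjoint; this takes the place of comparing spectral radii. *)
Theorem star_hom_contractive (a : A) : nrm (f a) <= nrm a.
Proof.
pose h := cstar a ** a.
suff : nrm (f h) <= nrm h.
  by rewrite fP.1 fP.2 !nrm_cstar_cmul ler_pXn2r // ?nnegrE ?nrm_ge0.
have hE : cstar h = h by rewrite cstarM cstarK.
apply: (@le_of_pow2_le _ _ _ 4 1%N (nrm_ge0 _) (nrm_ge0 _)) => k.
rewrite expr1n mulr1 -!nrm_sq_iter -sq_iter_hom //; apply: star_hom_bounded.
by case: k => [|k] //=; rewrite cstarM cstarK.
Qed.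

End Contractivity.

(** * Orthogonality of projections whose sum is a projection *)

Section RootsOfUnity.
Context {R : realType}.

Lemma prim_root_exists n : (0 < n)%N -> exists w : R[i], n.-primitive_root w.
Proof.
move=> n_gt0; have [r rE] := closed_field_poly_normal ('X^n - 1 : {poly R[i]}).
rewrite lead_coefXnsubC // scale1r in rE.
suff /hasP [w _ wn] : has n.-primitive_root r by exists w.
apply: has_prim_root => //.
- by apply/allP => z; rewrite -root_prod_XsubC -rE.
- by rewrite -separable_prod_XsubC -rE separable_Xn_sub_1 // pnatr_eq0 -lt0n.
- by rewrite -ltnS -(size_prod_XsubC r id) -rE size_XnsubC.
Qed.

Lemma norm_prim_root n (w : R[i]) : n.-primitive_root w -> `|w| = 1.
Proof.
move=> wn; apply/eqP; rewrite -(@pexpr_eq1 _ _ n) ?(prim_order_gt0 wn) //.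
by rewrite -normrX prim_expr_order // normr1.
Qed.

Lemma sum_prim_root n (w : R[i]) (i j : 'I_n) : n.-primitive_root w ->
  \sum_(l < n) w ^- (l * j) * w ^+ (l * i) = if i == j then n%:R else 0.
Proof.
move=> wn; have w0 : w != 0 by rewrite -normr_eq0 (norm_prim_root wn) oner_eq0.
pose r := w ^+ i / w ^+ j.
have rE l : w ^- (l * j) * w ^+ (l * i) = r ^+ l.
  by rewrite expr_div_n -!exprM mulrC [(i * l)%N]mulnC [(j * l)%N]mulnC.
under eq_bigr do rewrite rE.
have [ij|ij] := eqVneq i j.
  under eq_bigr do rewrite /r ij divff ?expf_neq0 // expr1n.
  by rewrite sumr_const card_ord.
have r1 : r - 1 != 0.
  rewrite subr_eq0; apply: contra ij => /eqP r1.
  have : w ^+ i == w ^+ j.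
    by apply/eqP; rewrite -[LHS](divfK (expf_neq0 j w0)) -/r r1 mul1r.
  by rewrite (eq_prim_root_expr wn) !modn_small.
apply: (mulfI r1); rewrite mulr0 -subrX1 expr_div_n -!exprM.
have wk k : w ^+ (k * n) = 1 by rewrite mulnC exprM (prim_expr_order wn) expr1n.
by rewrite !wk divr1 subrr.
Qed.

(** Fourier inversion on the n-th roots of unity: a coefficient is the mean of the n values with
    unimodular weights. It serves both as a Cauchy estimate and as the replacement for integrating
    over a circle. *)
Lemma nrm_coef_le (V : normedModType R[i]) n (w : R[i]) (y : 'I_n -> V) (C : R) :
  n.-primitive_root w ->
  (forall l : 'I_n, nrm (\sum_(j < n) w ^+ (l * j) *: y j) <= C) ->
  forall j, nrm (y j) <= C.
Proof.
move=> wn yC j; have n_gt0 := prim_order_gt0 wn.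
have w1 := norm_prim_root wn.
have -> : y j = n%:R^-1 *:
    \sum_(l < n) w ^- (l * j) *: (\sum_(i < n) w ^+ (l * i) *: y i).
  under eq_bigr do rewrite scaler_sumr.
  rewrite exchange_big /= (bigD1 j) //= [X in _ + X]big1 => [|i ij].
    under eq_bigr do rewrite scalerA.
    rewrite -scaler_suml sum_prim_root // eqxx addr0 scalerA mulVf ?scale1r //.
    by rewrite pnatr_eq0 -lt0n.
  under eq_bigr do rewrite scalerA.
  by rewrite -scaler_suml sum_prim_root // (negbTE ij) scale0r.
have n0 : 0 < n%:R :> R by rewrite ltr0n.
rewrite -(ler_pM2l n0) -nrmMn -scaler_nat scalerA divff ?scale1r ?pnatr_eq0 -?lt0n //.
apply: le_trans (nrm_sum _ _ _) _.
have -> : n%:R * C = \sum_(l < n) C by rewrite sumr_const card_ord mulr_natl.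
apply: ler_sum => l _; rewrite nrmZ1 //.
by rewrite normrV ?unitfE ?expf_neq0 ?normrX ?w1 ?expr1n ?invr1 // -normr_eq0 w1 oner_eq0.
Qed.

End RootsOfUnity.

(** * A projection is an extreme point of the unit ball of its corner *)

Section Extremality.
Context {R : realType} {A : cstarAlgType R} (e x : A).
Hypotheses (eP : projection e) (xE : cstar x = x) (ex : e ** x = x) (xe : x ** e = x).
Hypotheses (ex_le1 : nrm (e + x) <= 1) (eBx_le1 : nrm (e - x) <= 1).

Local Notation half := ((2^-1 : R)%:C%C : R[i]).

Let ee : e ** e = e := eP.2.
Let e_le1 : nrm e <= 1 := nrm_projection_le1 eP.

(** The conditions on c mean c = i or c = -i. Then (e + c x)^* (e + c x) = e + x^2, which is the
    mean of (e + x)^2 and (e - x)^2. *)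
Let nrm_e_ix (c : R[i]) : c ^+ 2 = -1 -> c^* = - c -> nrm (e + c *: x) <= 1.
Proof.
move=> c2 cC; rewrite -(ler_pXn2r (ltn0Sn 1)) ?nnegrE ?nrm_ge0 // expr1n.
have sq_le1 (y : A) : nrm y <= 1 -> nrm (y ** y) <= 1.
  by have := nrmM y y; have := nrm_ge0 y; nra.
rewrite -nrm_cstar_cmul cstarD cstarZ cC eP.1 xE cmulDl !cmulDr !cmulZl !cmulZr.
rewrite ee ex xe !scaleNr addrA addrK scalerA -expr2 c2 scaleN1r opprK.
have -> : e + x ** x = half *: ((e + x) ** (e + x) + (e - x) ** (e - x)).
  rewrite !cmulDl !cmulDr !cmulNl !cmulNr ee ex xe opprK.
  have -> : e + x + (x + x ** x) + (e - x + (- x + x ** x)) = (e + x ** x) + (e + x ** x).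
    by rewrite addrACA [e + x + _]addrACA [x + _ + _]addrACA subrr addr0 add0r addrACA.
  by rewrite half_double.
rewrite nrm_half; have := nrmD ((e + x) ** (e + x)) ((e - x) ** (e - x)).
by have := sq_le1 _ ex_le1; have := sq_le1 _ eBx_le1; lra.
Qed.

Let conj_i : ('i%C : R[i])^* = - 'i%C.
Proof. by apply/eqP; rewrite eq_complex /= oppr0 !eqxx. Qed.

(** For z = a + i b in the disc of radius 1/2 one has |a| + |b| <= 1, so e + z x is a convex
    combination of e, one of e + x and e - x, and one of e + i x and e - i x. *)
Let nrm_e_zx (z : R[i]) : `|z| <= half -> nrm (e + z *: x) <= 1.
Proof.
move=> z_le; pose a := complex.Re z; pose b := complex.Im z.
have seg (u : A) (r : R) : nrm (e + u) <= 1 -> nrm (e - u) <= 1 ->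
    nrm (`|r|%:C%C *: e + r%:C%C *: u) <= `|r|.
  move=> eu1 eu2; have [r0|r0] := ger0P r.
    by rewrite -scalerDr nrmZR // ler_piMr.
  have -> : r%:C%C *: u = (- r)%:C%C *: (- u) by rewrite rmorphN scaleNr scalerN opprK.
  rewrite -scalerDr nrmZR ?oppr_ge0; last exact: ltW.
  by rewrite ler_piMr // oppr_ge0 ltW.
have a_le : `|a| <= 2^-1 by rewrite -lecR; apply: le_trans z_le; exact: normc_ge_Re.
have b_le : `|b| <= 2^-1.
  rewrite -lecR; apply: le_trans z_le.
  have := normc_ge_Re (z * 'i%C); rewrite ReiNIm normrN normrM -/b.
  by rewrite [X in _ * X]normc_def /= expr0n add0r expr1n sqrtr1 mulr1.
have mix (X Y : A) : e + (X + Y) =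
    (`|a|%:C%C *: e + X) + (`|b|%:C%C *: e + Y) + (1 - `|a| - `|b|)%:C%C *: e.
  have eE : e = `|a|%:C%C *: e + `|b|%:C%C *: e + (1 - `|a| - `|b|)%:C%C *: e.
    rewrite -scalerDl -scalerDl -(rmorphD (real_complex R)) -(rmorphD (real_complex R)) /=.
    have -> : `|a| + `|b| + (1 - `|a| - `|b|) = 1 :> R by ring.
    by rewrite scale1r.
  rewrite {1}eE; move: (_ *: e) (_ *: e) (_ *: e) => p q r.
  by transitivity (r + q + (X + Y) + p); [rewrite addrAC | rewrite addrACA].
rewrite (complexE z) scalerDl mix mulrC -scalerA.
apply: le_trans (nrmD _ _) _; rewrite nrmZR; last by lra.
have h1 := seg x a ex_le1 eBx_le1.
have h2 : nrm (`|b|%:C%C *: e + b%:C%C *: ('i%C *: x)) <= `|b|.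
  apply: seg; first by apply: nrm_e_ix; [exact: sqr_i|exact: conj_i].
  rewrite -scaleNr; apply: nrm_e_ix; first by rewrite sqrrN sqr_i.
  by apply/eqP; rewrite eq_complex /= ?opprK ?oppr0 ?eqxx.
have h3 : (1 - `|a| - `|b|) * nrm e <= 1 - `|a| - `|b|.
  by rewrite ler_piMr //; lra.
have := nrmD (`|a|%:C%C *: e + a%:C%C *: x) (`|b|%:C%C *: e + b%:C%C *: ('i%C *: x)).
lra.
Qed.

(** Pascal's rule for the coefficient of z^j in (e + z x)^n; as e is a unit for x, this is x^j times
    a binomial coefficient. Only j = 0 and j = 1 are ever evaluated. *)
Fixpoint binomial_coef (n j : nat) : A :=
  match n, j with
  | 0, 0 => e
  | 0, _.+1 => 0
  | n'.+1, 0 => e ** binomial_coef n' 0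
  | n'.+1, j'.+1 => e ** binomial_coef n' j'.+1 + x ** binomial_coef n' j'
  end.

Let binomial_coef_gt n j : (n < j)%N -> binomial_coef n j = 0.
Proof.
elim: n j => [|n IHn] [|j] //= nj.
by rewrite !IHn ?cmul0r ?addr0 // ltnW.
Qed.

Let binomial_coef0 n : binomial_coef n 0 = e.
Proof. by elim: n => [|n IHn] //=; rewrite IHn. Qed.

Let binomial_coef1 n : binomial_coef n 1 = x *+ n.
Proof.
elim: n => [|n IHn]; first by rewrite mulr0n.
by rewrite /= IHn binomial_coef0 -scaler_nat cmulZr ex xe scaler_nat mulrSr.
Qed.

Let binomial_expansion (z : R[i]) n :
  iter n (cmul (e + z *: x)) e = \sum_(j < n.+1) z ^+ j *: binomial_coef n j.
Proof.
elim: n => [|n IHn]; first by rewrite big_ord1 expr0 scale1r.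
rewrite iterS IHn cmulDl cmulZl [RHS]big_ord_recl /=.
have extend : \sum_(j < n.+1) z ^+ j *: binomial_coef n j =
    \sum_(j < n.+2) z ^+ j *: binomial_coef n j.
  by rewrite [RHS]big_ord_recr /= (binomial_coef_gt (ltnSn n)) scaler0 addr0.
rewrite {1}extend big_ord_recl cmulDr !expr0 !scale1r -addrA; congr (_ + _).
rewrite !cmul_sumr scaler_sumr -big_split; apply: eq_bigr => j _ /=.
by rewrite !cmulZr scalerA -exprS scalerDr.
Qed.

(* [e] is an extreme point of the unit ball: [|e + z x| <= 1] on a disc, and the
   Cauchy estimate for the linear coefficient of [(e + z x) ^ n] bounds [n |x|]. *)
Lemma projection_extreme : x = 0.
Proof.
apply: nrm_eq0; apply/eqP; rewrite eq_le nrm_ge0 andbT leNgt; apply/negP => x0.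
(* The estimate on the circle of radius 1/2 yields n |x| / 2 <= 1, so n is taken with n |x| > 2. A
   polynomial of degree n is sampled at n + 1 roots of unity. *)
pose n := (Num.trunc (2 / nrm x)).+1.
have n_big : 2 < n%:R * nrm x by rewrite -ltr_pdivrMr // truncnS_gt.
have [w wn] := @prim_root_exists R n.+1 isT.
suff /(_ 1) : forall j : 'I_n.+1, nrm (half ^+ j *: binomial_coef n j) <= 1.
  by rewrite expr1 nrm_half binomial_coef1 nrmMn; lra.
apply: (nrm_coef_le (y := fun j : 'I_n.+1 => half ^+ j *: binomial_coef n j) wn) => l.
have -> : \sum_(j < n.+1) w ^+ (l * j) *: (half ^+ j *: binomial_coef n j)
    = iter n (cmul (e + (w ^+ l * half) *: x)) e.
  rewrite binomial_expansion; apply: eq_bigr => j _.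
  by rewrite scalerA exprM -exprMn.
set z := w ^+ l * half.
have z1 : nrm (e + z *: x) <= 1.
  by apply: nrm_e_zx; rewrite normrM normrX (norm_prim_root wn) expr1n mul1r ger0_norm ?half_ge0.
suff iter_le1 m : nrm (iter m (cmul (e + z *: x)) e) <= 1 by exact: iter_le1.
elim: m => [|m IHm] //=; apply: le_trans (nrmM _ _) _.
by have := nrm_ge0 (e + z *: x); nra.
Qed.

End Extremality.

Section SumsOfProjections.
Context {R : realType} {A : cstarAlgType R} {I : eqType}.
Implicit Types (r : seq I) (x p : I -> A).

(** Let m be the number of other terms. As x_i is minus their sum, m e + x_i is a sum of m elements
    e - x_j, of norm at most m; also m e - x_i = (m - 1) e + (e - x_i). So e + x_i/m and e - x_i/m
    lie in the unit ball, and extremality gives x_i = 0. *)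
Lemma sum_eq0_near_projection (e : A) r x : projection e ->
  (forall i, i \in r -> [/\ cstar (x i) = x i, e ** x i = x i, x i ** e = x i
                          & nrm (e - x i) <= 1]) ->
  \sum_(i <- r) x i = 0 -> forall i, i \in r -> x i = 0.
Proof.
move=> eP xP sum0 i ir; have [xS ex xe ex1] := xP i ir.
pose r' := rem i r; pose m := size r'.
have xiE : x i = - \sum_(j <- r') x j.
  by apply/eqP; rewrite -addr_eq0; move: sum0; rewrite (big_rem i ir) /= => ->.
have [m0|m0] := posnP m.
  by rewrite xiE (size0nil m0) big_nil oppr0.
have mR : 0 < m%:R :> R by rewrite ltr0n.
have le1 : nrm (e *+ m + x i) <= m%:R.
  have -> : e *+ m + x i = \sum_(j <- r') (e - x j).
    by rewrite sumrB xiE big_const_seq count_predT iter_addr_0.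
  apply: le_trans (nrm_sum _ _ _) _.
  have -> : m%:R = \sum_(j <- r') (1 : R) by rewrite big_const_seq count_predT iter_addr_0.
  by rewrite !big_seq; apply: ler_sum => j /mem_rem /xP[].
pose c : R[i] := (m%:R^-1 : R)%:C%C.
have cm (y : A) : c *: (y *+ m) = y.
  rewrite -scaler_nat scalerA -(rmorph_nat (real_complex R)) -rmorphM /=.
  by rewrite mulVf ?scale1r // gt_eqF.
have nrm_c (y : A) : nrm y <= m%:R -> nrm (c *: y) <= 1.
  by move=> ym; rewrite nrmZR ?invr_ge0 // ler_pdivrMl // mulr1.
have cC : c^* = c by rewrite geC0_conj // -[0](rmorph0 (real_complex R)) lecR invr_ge0.
suff x'0 : c *: x i = 0 by rewrite -[x i]cm -scalerMnr x'0 mul0rn.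
apply: (projection_extreme eP).
- by rewrite cstarZ cC xS.
- by rewrite cmulZr ex.
- by rewrite cmulZl xe.
- by rewrite -{1}[e]cm -scalerDr; exact: nrm_c.
- rewrite -{1}[e]cm -scalerBr; apply: nrm_c; rewrite -(prednK m0) mulrS addrAC.
  have e_le : m.-1%:R * nrm e <= m.-1%:R by rewrite ler_piMr // nrm_projection_le1.
  by apply: le_trans (nrmD _ _) _; rewrite nrmMn -natr1; lra.
Qed.

(** For k different from j the compressions [p j ** p k ** p j] sum to [p j ** q ** p j - p j = 0].
    Positivity would finish; its substitute is that each lies within distance 1 of [p j]. *)
Lemma orthogonal_of_sum_projection r p (q : A) : uniq r ->
  (forall i, i \in r -> projection (p i)) -> (forall i, i \in r -> p i ** q = p i) ->
  q = \sum_(i <- r) p i ->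
  {in r &, forall i j, i != j -> p i ** p j = 0}.
Proof.
move=> r_uniq pP pq qE i j ir jr ij.
have [eS ee] := pP j jr.
have pipj : p j ** p i ** p j = 0.
  apply: (sum_eq0_near_projection (x := fun k => p j ** p k ** p j) (pP j jr) _ _
    (r := rem j r) (i := i)).
- move=> k /mem_rem kr; have [kS kk] := pP k kr; split.
  + by rewrite !cstarM eS kS cmulA.
  + by rewrite !cmulA ee.
  + by rewrite -!cmulA ee.
  (* Here y^* y = p_j y, hence |y|^2 <= |y| and |y| <= 1; the norm to bound is |y|^2. *)
  pose y := p j - p k ** p j.
  have jy : p j - p j ** p k ** p j = p j ** y by rewrite cmulBr ee cmulA.
  have yy : cstar y ** y = p j ** y.
    rewrite cstarB cstarM eS kS cmulBl [p j ** p k ** y]cmulBr [p j ** p k ** (_ ** _)]cmulA.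
    by rewrite -[p j ** p k ** p k]cmulA kk subrr subr0.
  have := nrm_cstar_cmul y; have := nrmM (p j) y; rewrite jy yy.
  have y0 := nrm_ge0 y.
  have := ler_piMl y0 (nrm_projection_le1 (pP j jr)); nra.
- rewrite -cmul_suml -cmul_sumr.
  have -> : \sum_(k <- rem j r) p k = q - p j by rewrite qE (big_rem j jr) /= addrC addrK.
  by rewrite cmulBr pq // ee subrr cmul0l.
- by rewrite mem_rem_uniq // inE ij ir.
have [iS ii] := pP i ir.
apply: cstar_cmul_eq0.
by rewrite cstarM eS iS cmulA -[p j ** p i ** p i]cmulA ii pipj.
Qed.

End SumsOfProjections.

(** * The gauge-invariant uniqueness theorem *)

Lemma isometry_of_sq_iter_bound {R : realType} {A B : cstarAlgType R}
    (f : {linear A -> B}) (x : A) (C : R) (q : nat) : star_hom f ->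
  (forall k, nrm (sq_iter x k) <= C * q%:R ^+ k * nrm (f (sq_iter x k))) ->
  nrm x <= nrm (f x).
Proof.
move=> fP xC; apply: (@le_of_pow2_le _ _ _ C q (nrm_ge0 _) (nrm_ge0 _)) => k.
by rewrite -!nrm_sq_iter -sq_iter_hom.
Qed.

(** * Consequences of the Cuntz-Krieger relations *)

Section CuntzKrieger.
Context {R : realType} {L : ngraph} (L_row_finite : row_finite L).
Context {A : cstarAlgType R} (s : gpath L -> A) (sP : CK_family s).
Implicit Types (l m : gpath L) (v : vertex L).

Local Notation p v := (s (gid v)).
Local Notation cs l := (cstar (s l)).

Lemma CK_rng l : p (grng l) ** s l = s l.
Proof. by rewrite (CK2_comp sP) ?src_id // comp_idl. Qed.

Lemma CK_src l : s l ** p (gsrc l) = s l.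
Proof. by rewrite (CK2_comp sP) ?rng_id // comp_idr. Qed.

Lemma CK_cstar_rng l : cs l ** p (grng l) = cs l.
Proof. by rewrite -[RHS](congr1 cstar (CK_rng l)) cstarM (CK1_proj sP _).1. Qed.

Lemma CK_cstar_src l : p (gsrc l) ** cs l = cs l.
Proof. by rewrite -[RHS](congr1 cstar (CK_src l)) cstarM (CK1_proj sP _).1. Qed.

Lemma nrm_CK_le1 l : nrm (s l) <= 1.
Proof.
have := nrm_cstar_cmul (s l); rewrite (CK3 sP).
have := nrm_projection_le1 (CK1_proj sP (gsrc l)); have := nrm_ge0 (s l); nra.
Qed.

Lemma CK_range_sum v n : exists r : seq (gpath L),
  [/\ uniq r, forall l, l \in r = (grng l == v) && (gdeg l == n)
    & p v = \sum_(l <- r) s l ** cs l].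
Proof.
have fin := L_row_finite v n; exists (fset_set (paths_from v n)); split.
- exact: fset_uniq.
- move=> l; rewrite in_fset_set //; apply/idP/andP.
    by rewrite inE => -[-> ->]; rewrite !eqxx.
  by move=> [/eqP lv /eqP ln]; rewrite inE.
- by rewrite (CK4 sP v n) fsbig_finite.
Qed.

Lemma CK_range_projection l : projection (s l ** cs l).
Proof.
by split; [rewrite cstarM cstarK | rewrite cmulA (CK_pi sP l)].
Qed.

Lemma CK_cstar_mul_rng l m : grng l != grng m -> cs l ** s m = 0.
Proof.
move=> lm; rewrite -(CK_cstar_rng l) -(CK_rng m) cmulA -[cs l ** _ ** _]cmulA.
by rewrite (CK1_orth sP) // cmul0r cmul0l.
Qed.

(** For equal ranges, both range projections occur in one sum [CK4], which forces them to be
    orthogonal; multiplying by [cs l] and [s m] strips them down to [cs l ** s m]. *)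
Lemma CK_orthogonal l m : gdeg l = gdeg m -> l != m -> cs l ** s m = 0.
Proof.
move=> lm_deg lm; have [rlm|rlm] := eqVneq (grng l) (grng m); last first.
  exact: CK_cstar_mul_rng.
have [r [r_uniq rP pE]] := CK_range_sum (grng l) (gdeg l).
have := orthogonal_of_sum_projection r_uniq (fun k _ => CK_range_projection k) _ pE.
move=> /(_ _)/(_ l m); rewrite !rP !eqxx -rlm lm_deg !eqxx => H.
have {H} : s l ** cs l ** (s m ** cs m) = 0.
  apply: H => // k; rewrite rP => /andP[/eqP kr _].
  by rewrite -cmulA -kr CK_cstar_rng.
move=> /(congr1 (cmul (cs l))) /(congr1 (cmul^~ (s m))).
rewrite cmul0r cmul0l !cmulA (CK3 sP) CK_cstar_src -!cmulA (CK3 sP) CK_src.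
by [].
Qed.

Lemma CK_cstar_mul_comp l m : gsrc l = grng m -> cs l ** s (gcomp l m) = s m.
Proof. by move=> lm; rewrite -(CK2_comp sP lm) cmulA (CK3 sP) lm CK_rng. Qed.

(** Factor m with a first part of degree d(l): either this part is l, or it is orthogonal to l. *)
Lemma CK_cstar_mul_longer l m n : gdeg m = gdeg l + n ->
  cs l ** s m = 0 \/
  exists k, [/\ gsrc l = grng k, m = gcomp l k, gdeg k = n & cs l ** s m = s k].
Proof.
move=> /factorization [[l' k] [[/= l'k mE l'd kd] _]].
have [ll'|ll'] := eqVneq l l'.
  by right; exists k; rewrite mE ll' CK_cstar_mul_comp.
left; rewrite mE -(CK2_comp sP l'k) cmulA CK_orthogonal ?cmul0l //.
Qed.

End CuntzKrieger.

(** * Linear spans *)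

Section Span.
Context {R : realType} {A : cstarAlgType R}.
Implicit Types (G H K : A -> Prop) (x y : A).

Inductive lspan G : A -> Prop :=
| lspan0 : lspan G 0
| lspan_cons c g x : G g -> lspan G x -> lspan G (c *: g + x).

Lemma lspan_gen G g : G g -> lspan G g.
Proof. by move=> Gg; rewrite -[g]scale1r -[X in lspan _ X]addr0; constructor => //; constructor. Qed.

Lemma lspanD G x y : lspan G x -> lspan G y -> lspan G (x + y).
Proof.
move=> Gx Gy; elim: Gx => [|c g {}x Gg _ IHx]; first by rewrite add0r.
by rewrite -addrA; constructor.
Qed.

Lemma lspanZ G c x : lspan G x -> lspan G (c *: x).
Proof.
elim=> [|d g {}x Gg _ IHx]; first by rewrite scaler0; constructor.
by rewrite scalerDr scalerA; constructor.
Qed.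

Lemma lspan_sum G (I : eqType) (r : seq I) (F : I -> A) :
  (forall i, i \in r -> lspan G (F i)) -> lspan G (\sum_(i <- r) F i).
Proof.
move=> GF; rewrite big_seq; elim/big_rec: _ => [|i x ir Gx]; first exact: lspan0.
by apply: lspanD => //; exact: GF.
Qed.

Lemma lspan_sub G H x : (forall g, G g -> lspan H g) -> lspan G x -> lspan H x.
Proof.
move=> GH; elim=> [|c g {}x Gg _ IHx]; first exact: lspan0.
by apply: lspanD => //; apply/lspanZ/GH.
Qed.

Lemma lspanM G H K x y : (forall g h, G g -> H h -> lspan K (g ** h)) ->
  lspan G x -> lspan H y -> lspan K (x ** y).
Proof.
move=> GHK Gx Hy; elim: Gx => [|c g {}x Gg _ IHx]; first by rewrite cmul0l; exact: lspan0.
rewrite cmulDl cmulZl; apply: lspanD => //; apply: lspanZ.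
elim: Hy {IHx} => [|d h {}y Hh _ IHy]; first by rewrite cmul0r; exact: lspan0.
by rewrite cmulDr cmulZr; apply: lspanD => //; apply/lspanZ/GHK.
Qed.

Lemma lspan_cstar G H x : (forall g, G g -> lspan H (cstar g)) ->
  lspan G x -> lspan H (cstar x).
Proof.
move=> GH; elim=> [|c g {}x Gg _ IHx]; first by rewrite cstar0; exact: lspan0.
by rewrite cstarD cstarZ; apply: lspanD => //; apply/lspanZ/GH.
Qed.

End Span.

Lemma mdegD (m n : multidegree) i : (m + n) i = (m i + n i)%N.
Proof. exact: mdeg_addE. Qed.

Lemma mdeg_addI (m u v : multidegree) : m + u = m + v -> u = v.
Proof.
move=> muv; apply/fsfunP => i; apply/eqP; rewrite -(eqn_add2l (m i)).
by rewrite -!mdegD muv.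
Qed.

(** * Spans of the s_l s_m^* with prescribed degrees *)

Section BigradedSpan.
Context {R : realType} {L : ngraph} (L_row_finite : row_finite L).
Context {A : cstarAlgType R} (s : gpath L -> A) (sP : CK_family s).
Implicit Types (P Q T : multidegree -> multidegree -> Prop) (x y : A).

Local Notation cs l := (cstar (s l)).

(** A relation on pairs of degrees describes every subspace of the argument: one level, the core,
    the bands and the whole span. *)
Definition bispan P : A -> Prop := lspan (fun x =>
  exists l m : gpath L, P (gdeg l) (gdeg m) /\ x = s l ** cs m).

Lemma bispan_sub P Q x : (forall a b, P a b -> Q a b) -> bispan P x -> bispan Q x.
Proof.
move=> PQ; apply: lspan_sub => _ [l [m [Plm ->]]]; apply: lspan_gen.
by exists l, m; split=> //; exact: PQ.
Qed.

Lemma bispan_cstar P Q x : (forall a b, P a b -> Q b a) ->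
  bispan P x -> bispan Q (cstar x).
Proof.
move=> PQ; apply: lspan_cstar => _ [l [m [Plm ->]]]; apply: lspan_gen.
by exists m, l; rewrite cstarM cstarK; split=> //; exact: PQ.
Qed.

(* Expanding the middle unit over paths of degree [gdeg m + gdeg n] gives
   [cs m ** s n] as a sum of [s a ** cs b] over the [a], [b] with [m a = n b]. *)
Lemma bispanM P Q T x y :
  (forall a b c d u v : multidegree, P a b -> Q c d -> b + u = c + v -> T (a + u) (d + v)) ->
  bispan P x -> bispan Q y -> bispan T (x ** y).
Proof.
move=> PQT; apply: lspanM => _ _ [l [m [Plm ->]]] [n [k [Qnk ->]]].
have -> : s l ** cs m ** (s n ** cs k) = s l ** (cs m ** s n) ** cs k.
  by rewrite !cmulA.
have [mn|mn] := eqVneq (grng m) (grng n); last first.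
  by rewrite (CK_cstar_mul_rng sP mn) cmul0r cmul0l; exact: lspan0.
have [r [_ rP pE]] := CK_range_sum L_row_finite sP (grng m) (gdeg m + gdeg n).
rewrite -(CK_cstar_rng sP m) pE cmul_sumr cmul_suml cmul_sumr cmul_suml.
apply: lspan_sum => t; rewrite rP => /andP[_ /eqP t_deg].
have -> : s l ** (cs m ** (s t ** cs t) ** s n) ** cs k
    = s l ** (cs m ** s t) ** (cs t ** s n) ** cs k by rewrite !cmulA.
have [->|[a [ma ta a_deg ->]]] := CK_cstar_mul_longer L_row_finite sP t_deg.
  by rewrite cmul0r !cmul0l; exact: lspan0.
have := CK_cstar_mul_longer L_row_finite sP (l := n) (m := t) (n := gdeg m).
rewrite t_deg addrC => /(_ erefl) [nt|[b [nb tb b_deg ntE]]].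
  have -> : cs t ** s n = 0 by rewrite -[RHS]cstar0 -nt cstarM cstarK.
  by rewrite cmul0r !cmul0l; exact: lspan0.
have -> : cs t ** s n = cs b by rewrite -ntE cstarM cstarK.
have [la|la] := eqVneq (gsrc l) (grng a); last first.
  by rewrite (CK2_zero sP la) !cmul0l; exact: lspan0.
have [kb|kb] := eqVneq (gsrc k) (grng b); last first.
  rewrite -cmulA -cstarM (CK2_zero sP kb) cstar0 cmul0r; exact: lspan0.
apply: lspan_gen; exists (gcomp l a), (gcomp k b).
rewrite -!(CK2_comp sP) // cstarM !cmulA; split=> //.
rewrite !deg_comp // a_deg b_deg; apply: PQT Plm Qnk _.
by rewrite addrC.
Qed.

Lemma bispan_split P (label : multidegree -> multidegree -> nat) (n : nat) x :
  (forall a b, P a b -> label a b < n)%N -> bispan P x ->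
  exists y : 'I_n -> A, x = \sum_(j < n) y j /\
    forall j : 'I_n, bispan (fun a b => P a b /\ label a b = j :> nat) (y j).
Proof.
move=> Pn; elim=> [|c g {}x [l [m [Plm ->]]] _ [y [-> yP]]].
  by exists (fun=> 0); split=> [|j]; [rewrite big1 | exact: lspan0].
pose i := Ordinal (Pn _ _ Plm).
exists (fun j => (if j == i then c *: (s l ** cs m) else 0) + y j); split.
  by rewrite big_split /= -big_mkcond big_pred1_eq.
move=> j; apply: lspanD; last exact: yP.
case: ifP => [/eqP ->|_]; last exact: lspan0.
by apply/lspanZ/lspan_gen; exists l, m.
Qed.

End BigradedSpan.

(** * Isometry on the core *)

Section CoreIsometry.
Context {R : realType} {L : ngraph} (L_row_finite : row_finite L).
Context {A : cstarAlgType R} (s : gpath L -> A) (sP : CK_family s).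
Context {B : cstarAlgType R} (f : {linear A -> B}) (fP : star_hom f).
Hypothesis f_vertex : forall v : vertex L, f (s (gid v)) <> 0.
Implicit Types (l m : gpath L) (n : multidegree) (S T : seq (gpath L)) (x y : A).

Local Notation p v := (s (gid v)).
Local Notation cs l := (cstar (s l)).
Local Notation bispan := (bispan s).

Let level n (a b : multidegree) := a = n /\ b = n.

(** Over paths of one degree the s_l s_m^* multiply like matrix units, so compression isolates one
    entry. Its being a scalar multiple of a vertex projection is what lets [f] control it. *)
Lemma level_coef n x l m : bispan (level n) x -> gdeg l = n -> gdeg m = n ->
  exists z : R[i], cs l ** x ** s m = z *: p (gsrc l).
Proof.
move=> xP ln mn; elim: xP => [|c g {}x [l' [m' [[l'n m'n] ->]]] _ [z zE]].
  by exists 0; rewrite cmul0r cmul0l scale0r.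
suff [z' z'E] : exists z', cs l ** (s l' ** cs m') ** s m = z' *: p (gsrc l).
  exists (c * z' + z).
  by rewrite cmulDr cmulDl cmulZr cmulZl z'E zE scalerDl scalerA.
have -> : cs l ** (s l' ** cs m') ** s m = (cs l ** s l') ** (cs m' ** s m).
  by rewrite !cmulA.
have [<-|ll'] := eqVneq l l'; last first.
  exists 0; rewrite (CK_orthogonal L_row_finite sP _ ll') ?cmul0l ?scale0r //.
  by rewrite ln l'n.
have [->|m'm] := eqVneq m' m; last first.
  exists 0; rewrite (CK_orthogonal L_row_finite sP _ m'm) ?cmul0r ?scale0r //.
  by rewrite mn m'n.
rewrite !(CK3 sP); have [->|lm] := eqVneq (gsrc l) (gsrc m).
  by exists 1; rewrite (CK1_proj sP _).2 scale1r.
by exists 0; rewrite (CK1_orth sP) // scale0r.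
Qed.

Lemma level_mul n x y : bispan (level n) x -> bispan (level n) y ->
  bispan (level n) (x ** y).
Proof.
apply: lspanM => _ _ [l [m [[ln mn] ->]]] [l' [m' [[l'n m'n] ->]]].
have -> : s l ** cs m ** (s l' ** cs m') = s l ** (cs m ** s l') ** cs m'.
  by rewrite !cmulA.
have [->|ml'] := eqVneq m l'; last first.
  rewrite (CK_orthogonal L_row_finite sP _ ml') ?mn // cmul0r cmul0l.
  exact: lspan0.
rewrite (CK3 sP); have [ll'|ll'] := eqVneq (gsrc l) (gsrc l').
  by rewrite -ll' (CK_src sP); apply: lspan_gen; exists l, m'.
by rewrite (CK2_zero sP) ?rng_id // cmul0l; exact: lspan0.
Qed.

Let rangeP S : A := \sum_(l <- S) s l ** cs l.

Lemma rangeP_mul n S l : uniq S -> (forall m, m \in S -> gdeg m = n) -> l \in S ->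
  rangeP S ** s l = s l.
Proof.
move=> S_uniq Sn lS; rewrite cmul_suml (bigD1_seq l) //= big1_seq ?addr0.
  exact: (CK_pi sP).
move=> m /andP[ml mS]; rewrite -cmulA (CK_orthogonal L_row_finite sP _ ml) ?cmul0r //.
by rewrite !Sn.
Qed.

Lemma cstar_rangeP S : cstar (rangeP S) = rangeP S.
Proof. by rewrite cstar_sum; apply: eq_bigr => l _; rewrite cstarM cstarK. Qed.

(** Quantifying over all larger [T] lets the induction enlarge the support when a summand is
    added. *)
Lemma level_support_aux n x : bispan (level n) x -> exists S,
  (forall m, m \in S -> gdeg m = n) /\
  (forall T, uniq T -> (forall m, m \in T -> gdeg m = n) -> {subset S <= T} ->
    rangeP T ** x = x /\ x ** rangeP T = x).
Proof.
move=> xP; elim: xP => [|c g {}x [l [m [[ln mn] ->]]] _ [S [Sn ST]]].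
  by exists [::]; split=> // T *; rewrite cmul0l cmul0r.
exists [:: l, m & S]; split=> [k|T T_uniq Tn ST'].
  by rewrite !inE => /or3P[/eqP ->|/eqP ->|/Sn].
have [lT mT] : l \in T /\ m \in T by split; apply: ST'; rewrite !inE eqxx ?orbT.
have [|xl xr] := ST T T_uniq Tn; first by move=> k kS; apply: ST'; rewrite !inE kS !orbT.
rewrite cmulDl cmulDr cmulZl cmulZr xl xr cmulA (rangeP_mul T_uniq Tn lT); split=> //.
rewrite -cmulA; congr (_ *: (_ ** _) + _).
by rewrite -[RHS](congr1 cstar (rangeP_mul T_uniq Tn mT)) cstarM cstar_rangeP.
Qed.

Lemma level_support n x : bispan (level n) x -> exists S,
  [/\ uniq S, forall m, m \in S -> gdeg m = n, rangeP S ** x = x & x ** rangeP S = x].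
Proof.
move=> /level_support_aux [S [Sn ST]]; exists (undup S).
have Sn' m : m \in undup S -> gdeg m = n by rewrite mem_undup => /Sn.
have [|? ?] := ST (undup S) (undup_uniq _) Sn'; first by move=> m; rewrite mem_undup.
by split=> //; exact: undup_uniq.
Qed.

Lemma level_bound n S x : bispan (level n) x -> (forall m, m \in S -> gdeg m = n) ->
  rangeP S ** x = x -> x ** rangeP S = x -> nrm x <= (size S * size S)%:R * nrm (f x).
Proof.
move=> xP Sn Px xP'.
have nrm_entry l m : gdeg l = n -> gdeg m = n -> nrm (cs l ** x ** s m) <= nrm (f x).
  move=> ln mn; have [z zE] := level_coef xP ln mn.
  apply: (@le_trans _ _ (nrm (f (cs l ** x ** s m)))).
    rewrite zE linearZ /= !nrmZ ler_wpM2l //; first exact: (Re_le (z := 0)).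
    (* [f] sends the vertex projection to a nonzero projection, which has norm 1. This is where
       [f_vertex] enters. *)
    rewrite [leRHS]nrm_projection ?nrm_projection_le1 //; first exact: CK1_proj.
    have [pS pp] := CK1_proj sP (gsrc l).
    by split; [rewrite -fP.2 pS | rewrite -fP.1 pp].
  rewrite !fP.1; apply: le_trans (nrmM _ _) _.
  apply: le_trans (ler_wpM2r (nrm_ge0 _) (nrmM _ _)) _.
  have := star_hom_contractive fP (cs l); have := star_hom_contractive fP (s m).
  rewrite nrm_cstar; have := nrm_CK_le1 sP l; have := nrm_CK_le1 sP m.
  have := nrm_ge0 (f (cs l)); have := nrm_ge0 (f (s m)); have := nrm_ge0 (f x).
  move=> h1 h2 h3 h4 h5 h6 h7.
  have : nrm (f (cs l)) * nrm (f x) <= nrm (f x) by rewrite ler_piMl //; lra.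
  by move=> h8; rewrite (le_trans _ h8) // ler_piMr ?mulr_ge0 //; lra.
have xE : x = \sum_(l <- S) \sum_(m <- S) s l ** (cs l ** x ** s m) ** cs m.
  transitivity (rangeP S ** x ** rangeP S); first by rewrite Px xP'.
  rewrite !cmul_suml; apply: eq_bigr => l _; rewrite cmul_sumr.
  by apply: eq_bigr => m _; rewrite !cmulA.
rewrite {1}xE; apply: le_trans (nrm_sum _ _ _) _.
have -> : (size S * size S)%:R * nrm (f x) = \sum_(l <- S) \sum_(m <- S) nrm (f x).
  rewrite !big_const_seq !count_predT !iter_addr_0 -mulr_natl natrM -mulr_natl; ring.
rewrite !big_seq; apply: ler_sum => l lS; apply: le_trans (nrm_sum _ _ _) _.
rewrite !big_seq; apply: ler_sum => m mS.
apply: le_trans (nrmM _ _) _; apply: le_trans (ler_wpM2r (nrm_ge0 _) (nrmM _ _)) _.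
rewrite nrm_cstar; have := nrm_entry l m (Sn l lS) (Sn m mS).
have := nrm_CK_le1 sP l; have := nrm_CK_le1 sP m; have := nrm_ge0 (s l).
have := nrm_ge0 (s m); have := nrm_ge0 (cs l ** x ** s m).
move: (nrm (s l)) (nrm (s m)) (nrm _) (nrm _) => a b c d h1 h2 h3 h4 h5 h6.
apply: le_trans h6; rewrite -[leRHS]mulr1 ler_pM ?mulr_ge0 //; last by rewrite ler_piMl.
Qed.

(** All iterates keep the support [S] of x, so the factor lost is the same at every stage and q =
    1. *)
Lemma level_isometry n x : bispan (level n) x -> nrm x <= nrm (f x).
Proof.
move=> xP; have [S [_ Sn Sx xS]] := level_support xP.
apply: (isometry_of_sq_iter_bound (C := (size S * size S)%:R) (q := 1%N) fP) => k.
rewrite expr1n mulr1; suff [yP Sy yS] : [/\ bispan (level n) (sq_iter x k),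
    rangeP S ** sq_iter x k = sq_iter x k & sq_iter x k ** rangeP S = sq_iter x k].
  exact: level_bound yP Sn Sy yS.
elim: k => [|k [yP Sy yS]] //=; split.
- by apply: level_mul (yP); apply: bispan_cstar (yP) => a b [-> ->].
- by rewrite cmulA -cstar_rangeP -cstarM yS.
- by rewrite -cmulA yS.
Qed.

(** Inserting [CK4] at the common source of l and k lengthens both paths by m. Hence any two levels
    lie in a common one, and each core element lies in a single level. *)
Lemma level_lift n (m : multidegree) x :
  bispan (level n) x -> bispan (level (n + m : multidegree)) x.
Proof.
apply: lspan_sub => _ [l [k [[ln kn] ->]]].
rewrite -(CK_src sP l); have [lk|lk] := eqVneq (gsrc l) (gsrc k); last first.
  rewrite -cmulA -(CK_cstar_src sP k) [p _ ** (_ ** _)]cmulA (CK1_orth sP) //.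
  by rewrite cmul0l cmul0r; exact: lspan0.
have [r [_ rP ->]] := CK_range_sum L_row_finite sP (gsrc l) m.
rewrite cmul_sumr cmul_suml; apply: lspan_sum => t; rewrite rP => /andP[/eqP tl /eqP tm].
apply: lspan_gen; exists (gcomp l t), (gcomp k t).
rewrite !deg_comp ?lk ?tl // ln kn tm; split=> //.
by rewrite -!(CK2_comp sP) ?tl // cstarM !cmulA.
Qed.

Lemma core_isometry x : bispan (fun a b => a = b) x -> nrm x <= nrm (f x).
Proof.
move=> xP; suff [n /level_isometry] : exists n, bispan (level n) x by [].
elim: xP => [|c g {}x [l [m [lm ->]]] _ [n nx]]; first by exists 0; exact: lspan0.
exists (gdeg l + n); apply: lspanD; last by rewrite addrC; exact: level_lift.
by apply/lspanZ/level_lift/lspan_gen; exists l, m.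
Qed.

End CoreIsometry.

(** * From the core to the whole algebra by the gauge action *)

Section GaugeInvariance.
Context {R : realType} {L : ngraph} (L_row_finite : row_finite L).
Context {A : cstarAlgType R} (s : gpath L -> A) (sP : CK_family s).
Context (alpha : torus R -> {linear A -> A}) (alphaP : gauge_action s alpha).
Context {B : cstarAlgType R} (f : {linear A -> B}) (fP : star_hom f).
Context (beta : torus R -> {linear B -> B}) (betaP : torus_action beta).
Hypothesis f_equivariant : forall t (a : A), f (alpha t a) = beta t (f a).
Hypothesis f_vertex : forall v : vertex L, f (s (gid v)) <> 0.
Implicit Types (l m : gpath L) (a b c d u v : multidegree) (x y : A).

Local Notation bispan := (bispan s).

Definition coord_torus (k : nat) (z : circle R) : torus R :=
  fun i => if i == k then z else 1%g.

Lemma coord_torus_pow k z a : torus_pow (coord_torus k z) a = circle_val z ^+ a k.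
Proof.
rewrite /torus_pow /coord_torus; have [ka|ka] := boolP (k \in finsupp a).
  rewrite (big_fsetD1 k ka) /= eqxx big1_fset ?mulr1 // => i.
  by rewrite !inE => /andP[/negbTE -> _] _; rewrite expr1n.
rewrite big1_fset => [|i ia _]; first by rewrite (fsfun_dflt ka) expr0.
by case: eqP ka => [<-|_ _]; [rewrite ia | rewrite expr1n].
Qed.

(** The weight of x in the k-th circle is j - n; multiplying by z^n keeps exponents natural. *)
Lemma gauge_homogeneous k z (n j : nat) x :
  bispan (fun a b => a k + n = b k + j)%N x ->
  circle_val z ^+ n *: alpha (coord_torus k z) x = circle_val z ^+ j *: x.
Proof.
have [[alpha_aut _ _ _] alpha_s] := alphaP.
have [alphaM alphaS] := (alpha_aut (coord_torus k z)).1.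
elim=> [|c g {}x [l [m [abj ->]]] _ IHx]; first by rewrite linear0 !scaler0.
rewrite linearD linearZ /= !scalerDr IHx; congr (_ + _).
rewrite alphaM alphaS !alpha_s !coord_torus_pow cstarZ cmulZl cmulZr !scalerA.
congr (_ *: _); rewrite -[RHS]mulrC -!mulrA [LHS]mulrCA; congr (c * _).
set w := circle_val z; have w1 : w * w^* = 1.
  by rewrite -normCK circle_normP expr1n.
rewrite rmorphXn /= mulrA -exprD addnC abj exprD mulrAC -exprMn.
by rewrite w1 expr1n mul1r.
Qed.

(** The induction on k starts at [equal_from 0], the core. To pass from [equal_from k] to
    [equal_from k.+1], the weights in coordinate k are confined to the interval from -n to n by
    [band k n]. *)
Let equal_from k a b := forall i, (k <= i)%N -> a i = b i.
Let band k n a b := [/\ equal_from k.+1 a b, (a k <= b k + n)%N & (b k <= a k + n)%N].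

Lemma band_exists k x : bispan (equal_from k.+1) x -> exists n, bispan (band k n) x.
Proof.
elim=> [|c g {}x [l [m [lm ->]]] _ [n xn]]; first by exists 0; exact: lspan0.
exists (n + gdeg l k + gdeg m k)%N; apply: lspanD.
  apply/lspanZ/lspan_gen; exists l, m; split=> //; split=> //; lia.
apply: bispan_sub xn => a b [ab ? ?]; split=> //; lia.
Qed.

Lemma band_sq_iter k n x j : bispan (band k n) x ->
  bispan (band k (n * 2 ^ j)) (sq_iter x j).
Proof.
move=> xn; elim: j => [|j IHj]; first by rewrite muln1.
apply: (bispanM L_row_finite sP (P := band k (n * 2 ^ j)) (Q := band k (n * 2 ^ j)) _ _ IHj).
  move=> a b c d u v [ab ? ?] [cd ? ?] bucv.
  have bucvi i : (b i + u i = c i + v i)%N by rewrite -!mdegD bucv.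
  rewrite expnS mulnCA; split.
  - by move=> i ki; rewrite !mdegD ab // -cd // bucvi.
  - by rewrite !mdegD; have := bucvi k; lia.
  - by rewrite !mdegD; have := bucvi k; lia.
by apply: bispan_cstar (IHj) => a b [ab ? ?]; split=> // i ki; rewrite ab.
Qed.

Lemma band_bound k n x :
  (forall y, bispan (equal_from k) y -> nrm y <= nrm (f y)) ->
  bispan (band k n) x -> nrm x <= (2 * n + 1)%:R * nrm (f x).
Proof.
move=> IHk xn.
(* The label is the weight shifted by n; the band condition prevents truncation and puts it between
   0 and 2n. *)
have [|y [xE yP]] := bispan_split (n := (2 * n).+1)
  (label := (fun a b => a k + n - b k)%N) _ xn.
  by move=> a b [_ ? ?]; lia.
(* [y j] has a single weight in coordinate k, so y_j^* y_j has weight 0 there and the induction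
   hypothesis applies to it; the C*-identity carries the bound back to [y j]. *)
have y_iso j : nrm (y j) <= nrm (f (y j)).
  rewrite -(ler_pXn2r (ltn0Sn 1)) ?nnegrE ?nrm_ge0 // -!nrm_cstar_cmul -fP.2 -fP.1.
  apply: IHk; apply: (bispanM L_row_finite sP _ _ (yP j)); last first.
    by apply: bispan_cstar (yP j) => a b; exact: id.
  move=> a b c d u v [[ab ? ?] abj] [[cd ? ?] cdj] bucv i; rewrite leq_eqVlt.
  have bucvi i' : (b i' + u i' = c i' + v i')%N by rewrite -!mdegD bucv.
  rewrite !mdegD => /predU1P[<-|ki]; first by have := bucvi k; lia.
  by have := ab i ki; have := cd i ki; have := bucvi i; lia.
have [w wn] := @prim_root_exists R (2 * n).+1 isT.
have w1 := norm_prim_root wn.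
have fy_le j : nrm (f (y j)) <= nrm (f x).
  apply: (nrm_coef_le (y := fun j => f (y j)) wn) => l.
  have wl1 : `|w ^+ l| = 1 by rewrite normrX w1 expr1n.
  pose z := mk_circle wl1.
  (* The torus element z = w^l scales [y j] by z^(j - n), so by equivariance this Fourier sum is a
     unimodular multiple of beta_z (f x), of norm at most |f x|. *)
  have -> : \sum_(j < (2 * n).+1) w ^+ (l * j) *: f (y j) =
      w ^+ (l * n) *: beta (coord_torus k z) (f x).
    rewrite -f_equivariant {1}xE !linear_sum; apply: eq_bigr => i _ /=.
    have : bispan (fun a b => a k + n = b k + i)%N (y i).
      by apply: bispan_sub (yP i) => a b [[_ ? ?] ?]; lia.
    move=> /(@gauge_homogeneous k z n i) /(congr1 f).
    by rewrite !linearZ /= -!exprM => ->.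
  rewrite nrmZ1 ?normrX ?w1 ?expr1n //; apply: star_hom_contractive.
  by have [/(_ (coord_torus k z))[]] := betaP.
rewrite xE; apply: le_trans (nrm_sum _ _ _) _; rewrite -xE.
have -> : (2 * n + 1)%:R * nrm (f x) = \sum_(j < (2 * n).+1) nrm (f x).
  by rewrite sumr_const card_ord addn1 mulr_natl.
by apply: ler_sum => j _; apply: le_trans (y_iso j) (fy_le j).
Qed.

(* One circle at a time: the number of spectral components in the [k]-th
   coordinate grows linearly under powers, whereas norms grow exponentially. *)
Lemma equal_from_isometry k x : bispan (equal_from k) x -> nrm x <= nrm (f x).
Proof.
elim: k x => [|k IHk] x.
  move=> xP; apply: (core_isometry L_row_finite sP fP f_vertex).
  by apply: bispan_sub xP => a b ab; apply/fsfunP => i; exact: ab.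
move=> /band_exists [n xn].
(* The j-th iterate has width n 2^j, and 2 n 2^j + 1 <= (2n + 1) 2^j. *)
apply: (isometry_of_sq_iter_bound (C := (2 * n + 1)%:R) (q := 2) fP) => j.
apply: le_trans (band_bound IHk (band_sq_iter j xn)) _.
rewrite ler_wpM2r ?nrm_ge0 // -natrX -natrM ler_nat.
by have := expn_gt0 2 j; lia.
Qed.

(** Finite support of degrees brings a finite combination into some [equal_from k]: beyond k all its
    degrees vanish. *)
Lemma bispan_isometry x : bispan (fun _ _ => True) x -> nrm x <= nrm (f x).
Proof.
move=> xP; suff [k] : exists k, bispan (equal_from k) x by exact: equal_from_isometry.
have deg_bound a : exists k, forall i, (k <= i)%N -> a i = 0%N.
  exists (\max_(i <- finsupp a) i).+1 => i; apply: contraTeq => ai.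
  by rewrite -leqNgt leq_bigmax_seq // mem_finsupp.
elim: xP => [|c g {}x [l [m [_ ->]]] _ [k xk]]; first by exists 0; exact: lspan0.
have [k1 k1P] := deg_bound (gdeg l); have [k2 k2P] := deg_bound (gdeg m).
exists (k + k1 + k2)%N; apply: lspanD.
  apply/lspanZ/lspan_gen; exists l, m; split=> // i ki.
  by rewrite k1P ?k2P //; lia.
by apply: bispan_sub xk => a b ab i ki; apply: ab; lia.
Qed.

(** The elements approximable from the span form a C*-subalgebra containing each [s l], hence
    everything. *)
Lemma bispan_dense (s_gen : cstar_generates s) x (e : R) : 0 < e ->
  exists2 y, bispan (fun _ _ => True) y & nrm (x - y) < e.
Proof.
pose S : set A := [set x | forall e : R, 0 < e ->
  exists2 y, bispan (fun _ _ => True) y & nrm (x - y) < e].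
suff SE : S = setT by have Sx : S x; [rewrite SE | exact: Sx].
apply: s_gen; last first.
  move=> l e' e'0; exists (s l); last by rewrite subrr nrm0.
  apply: lspan_gen; exists l, (gid (gsrc l)); split=> //.
  by rewrite (CK1_proj sP _).1 (CK_src sP).
split.
- by move=> e' e'0; exists 0; [exact: lspan0 | rewrite subrr nrm0].
- move=> z a b Sa Sb e' e'0; pose K := complex.Re `|z| + 1.
  have z0 : 0 <= complex.Re `|z| by exact: (Re_le (z := 0)).
  have K0 : 0 < K by rewrite /K; lra.
  have [|a' a'P aa'] := Sa (e' / (2 * K)); first by rewrite divr_gt0 // mulr_gt0.
  have [|b' b'P bb'] := Sb (e' / 2); first by rewrite divr_gt0.
  exists (z *: a' + b'); first by apply: lspanD => //; exact: lspanZ.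
  have -> : z *: a + b - (z *: a' + b') = z *: (a - a') + (b - b').
    by rewrite scalerBr opprD addrACA.
  apply: le_lt_trans (nrmD _ _) _; rewrite nrmZ.
  rewrite ltr_pdivlMr ?mulr_gt0 // in aa'.
  by have := nrm_ge0 (a - a'); rewrite /K in aa'; nra.
- move=> a b Sa Sb e' e'0; have b0 := nrm_ge0 b.
  have [|a' a'P aa'] := Sa (e' / (2 * (nrm b + 1))).
    by rewrite divr_gt0 // mulr_gt0 //; lra.
  have a'0 := nrm_ge0 a'.
  (* b' is chosen after a', its tolerance depending on |a'|. *)
  have [|b' b'P bb'] := Sb (e' / (2 * (nrm a' + 1))).
    by rewrite divr_gt0 // mulr_gt0 //; lra.
  exists (a' ** b').
    by apply: (bispanM L_row_finite sP _ a'P b'P).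
  have -> : a ** b - a' ** b' = (a - a') ** b + a' ** (b - b').
    by rewrite cmulBl cmulBr addrA subrK.
  apply: le_lt_trans (nrmD _ _) _; apply: le_lt_trans (lerD (nrmM _ _) (nrmM _ _)) _.
  rewrite ltr_pdivlMr in aa'; last by lra.
  rewrite ltr_pdivlMr in bb'; last by lra.
  by have := nrm_ge0 (a - a'); have := nrm_ge0 (b - b'); nra.
- move=> a Sa e' e'0; have [a' a'P aa'] := Sa e' e'0.
  exists (cstar a'); first by apply: bispan_cstar a'P.
  by rewrite -cstarB nrm_cstar.
- move=> a aS e' e'0.
  have e2 : 0 < (e' / 2)%:C%C :> R[i] by rewrite -[0](rmorph0 (real_complex R)) ltcR; lra.
  have [b [Sb ab]] := aS _ (nbhsx_ballx a _ e2).
  rewrite -ball_normE /= nrmE ltcR in ab.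
  have [|c cP bc] := Sb (e' / 2); first by lra.
  exists c => //; rewrite -[a](subrK b) -addrA.
  by apply: le_lt_trans (nrmD _ _) _; lra.
Qed.

Theorem gauge_invariant_uniqueness : cstar_generates s -> injective f.
Proof.
move=> s_gen x y fxy; apply/eqP; rewrite -subr_eq0; apply/eqP/nrm_eq0.
apply/eqP; rewrite eq_le nrm_ge0 andbT; apply/ler_addgt0Pr => e e0; rewrite add0r.
have [|z zP xyz] := bispan_dense s_gen (x - y) (e := e / 2); first by rewrite divr_gt0.
rewrite -[x - y](subrK z); apply: le_trans (nrmD _ _) _.
have := bispan_isometry zP; have := star_hom_contractive fP (x - y - z).
by rewrite linearB linearB fxy subrr sub0r nrmN; lra.
Qed.

End GaugeInvariance.

(** * Bounded operators on a Hilbert space *)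

(* A complex inner product space, described by the real part [hip] of its inner
   product. *)
Record prehilbert (R : realType) := Prehilbert {
  hspace :> lmodType R[i];
  hip : hspace -> hspace -> R;
  hipC : forall x y, hip x y = hip y x;
  hipDr : forall x y z, hip x (y + z) = hip x y + hip x z;
  hipZl : forall (c : R[i]) x y, hip (c *: x) y = hip x (c^* *: y);
  hipZr_real : forall (r : R) x y, hip x (r%:C%C *: y) = r * hip x y;
  hip_ge0 : forall x, 0 <= hip x x;
  hip_eq0 : forall x, hip x x = 0 -> x = 0
}.

Definition hnorm (R : realType) (H : prehilbert R) (x : H) : R := Num.sqrt (hip x x).

Section InnerProduct.
Context {R : realType} {H : prehilbert R}.
Implicit Types x y z : H.

Lemma hipDl x y z : hip (x + y) z = hip x z + hip y z.
Proof. by rewrite hipC hipDr !(hipC z). Qed.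

Lemma hipNr x y : hip x (- y) = - hip x y.
Proof. by rewrite -scaleN1r -(rmorphN1 (real_complex R)) hipZr_real mulN1r. Qed.

Lemma hipNl x y : hip (- x) y = - hip x y.
Proof. by rewrite hipC hipNr hipC. Qed.

Lemma hipBr x y z : hip x (y - z) = hip x y - hip x z.
Proof. by rewrite hipDr hipNr. Qed.

Lemma hipBl x y z : hip (x - y) z = hip x z - hip y z.
Proof. by rewrite hipDl hipNl. Qed.

Lemma hip0r x : hip x 0 = 0.
Proof. by rewrite -(subrr x) hipBr subrr. Qed.

Lemma hip_ext x y : (forall z, hip x z = hip y z) -> x = y.
Proof.
move=> xy; apply/eqP; rewrite -subr_eq0; apply/eqP/hip_eq0.
by rewrite hipBl xy subrr.
Qed.

Lemma hnorm_ge0 x : 0 <= hnorm x.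
Proof. exact: sqrtr_ge0. Qed.

Lemma sqr_hnorm x : hnorm x ^+ 2 = hip x x.
Proof. by rewrite sqr_sqrtr ?hip_ge0. Qed.

Lemma hnorm0 : hnorm (0 : H) = 0.
Proof. by rewrite /hnorm hip0r sqrtr0. Qed.

Lemma hnorm_eq0 x : hnorm x = 0 -> x = 0.
Proof. by move=> x0; apply: hip_eq0; rewrite -sqr_hnorm x0 expr0n. Qed.

Lemma hnormN x : hnorm (- x) = hnorm x.
Proof. by rewrite /hnorm hipNl hipNr opprK. Qed.

Lemma hnormZ (c : R[i]) x : hnorm (c *: x) = complex.Re `|c| * hnorm x.
Proof.
have c0 : 0 <= complex.Re `|c| by exact: (Re_le (z := 0)).
apply: (pexpIrn (ltn0Sn 1)); rewrite ?nnegrE ?mulr_ge0 ?hnorm_ge0 //.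
by rewrite exprMn !sqr_hnorm hipZl scalerA mulrC -normCK -hipZr_real rmorphXn.
Qed.

Lemma cauchy_schwarz x y : hip x y <= hnorm x * hnorm y.
Proof.
have [x0|x0] := eqVneq (hnorm x) 0.
  by rewrite (hnorm_eq0 x0) hipC hip0r hnorm0 mul0r.
have [y0|y0] := eqVneq (hnorm y) 0.
  by rewrite (hnorm_eq0 y0) hip0r hnorm0 mulr0.
have xx : 0 < hnorm x by rewrite lt_def x0 hnorm_ge0.
have yy : 0 < hnorm y by rewrite lt_def y0 hnorm_ge0.
(* This square expands to 2 |x| |y| (|x| |y| - <x, y>). *)
have := hip_ge0 ((hnorm y)%:C%C *: x - (hnorm x)%:C%C *: y).
rewrite hipBr !hipZr_real !hipBl ![hip (_ *: _) _]hipC !hipZr_real (hipC y x).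
rewrite -!sqr_hnorm => h.
have : 0 <= 2 * (hnorm x * hnorm y) * (hnorm x * hnorm y - hip x y).
  by apply: le_trans h _; rewrite le_eqVlt; apply/orP; left; apply/eqP; ring.
by rewrite pmulr_rge0 ?mulr_gt0 // subr_ge0.
Qed.

Lemma hnormD x y : hnorm (x + y) <= hnorm x + hnorm y.
Proof.
rewrite -(ler_pXn2r (ltn0Sn 1)) ?nnegrE ?addr_ge0 ?hnorm_ge0 //.
rewrite sqr_hnorm hipDl !hipDr (hipC y x) -!sqr_hnorm.
have := cauchy_schwarz x y; nra.
Qed.

Lemma hnormB x y : hnorm (x - y) <= hnorm x + hnorm y.
Proof. by rewrite -(hnormN y) hnormD. Qed.

End InnerProduct.

(** Completeness is phrased for geometric sequences with an explicit rate, the form in which limits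
    of operators are built. *)
Record hilbert (R : realType) := Hilbert {
  hpre :> prehilbert R;
  hip_complete : forall u : nat -> hpre,
    (forall n, hnorm (u n.+1 - u n) <= 2^-1 ^+ n) ->
    exists l, forall n, hnorm (l - u n) <= 2 * 2^-1 ^+ n
}.

Section BoundedOperators.
Context {R : realType}.

(** The adjoint is part of the data, which bypasses Riesz representation; additivity follows from
    its existence, and [bop_ext] shows that it is determined by the operator. *)
Record bop (H : hilbert R) := Bop {
  bfun : H -> H;
  badj : H -> H;
  badjP : forall x y, hip (bfun x) y = hip x (badj y);
  bfunZ : forall (c : R[i]) x, bfun (c *: x) = c *: bfun x;
  bfun_bounded : exists C, forall x, hnorm (bfun x) <= C * hnorm x
}.

Context {H : hilbert R}.
Implicit Types (a b : bop H) (x y : H).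

Lemma bop_ext a b : (forall x, bfun a x = bfun b x) -> a = b.
Proof.
move=> ab; have ab1 : bfun a = bfun b by apply/funext.
have ab2 : badj a = badj b.
  by apply/funext => y; apply: hip_ext => x; rewrite !(hipC _ x) -!badjP ab.
case: a b ab1 ab2 {ab} => [f g fg fZ fC] [f' g' fg' fZ' fC'] /= ff gg.
by subst; congr Bop; exact: Prop_irrelevance.
Qed.

Lemma bfunD a x y : bfun a (x + y) = bfun a x + bfun a y.
Proof. by apply: hip_ext => z; rewrite hipDl !badjP hipDl. Qed.

Lemma bfun0 a : bfun a 0 = 0.
Proof. by have := bfunZ a 0 0; rewrite !scale0r. Qed.

Lemma badjPl a x y : hip (badj a x) y = hip x (bfun a y).
Proof. by rewrite hipC -badjP hipC. Qed.

Lemma badjZ a (c : R[i]) x : badj a (c *: x) = c *: badj a x.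
Proof. by apply: hip_ext => y; rewrite badjPl !hipZl badjPl bfunZ. Qed.

Lemma badj_le a (C : R) : (forall x, hnorm (bfun a x) <= C * hnorm x) ->
  forall x, hnorm (badj a x) <= C * hnorm x.
Proof.
move=> aC x; have [x0|x0] := eqVneq (hnorm (badj a x)) 0.
  rewrite x0; apply: le_trans (hnorm_ge0 (bfun a x)) (aC x).
have x_gt0 : 0 < hnorm (badj a x) by rewrite lt_def x0 hnorm_ge0.
rewrite -(ler_pM2l x_gt0) -expr2 sqr_hnorm -badjP mulrA [_ * C]mulrC.
apply: le_trans (cauchy_schwarz _ _) _.
by rewrite ler_wpM2r ?hnorm_ge0.
Qed.

Fact bop_zero_adj x y : hip (0 : H) y = hip x (0 : H).
Proof. by rewrite hipC !hip0r. Qed.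

Fact bop_zero_bounded : exists C : R, forall x, hnorm (0 : H) <= C * hnorm x.
Proof. by exists 0 => x; rewrite hnorm0 mul0r. Qed.

Definition bop_zero : bop H :=
  Bop bop_zero_adj (fun c x => esym (scaler0 _ c)) bop_zero_bounded.

Definition bop_add a b : bop H.
Proof.
exists (fun x => bfun a x + bfun b x) (fun x => badj a x + badj b x).
- by move=> x y; rewrite hipDl hipDr !badjP.
- by move=> c x; rewrite !bfunZ scalerDr.
- have [C aC] := bfun_bounded a; have [D bD] := bfun_bounded b; exists (C + D) => x.
  by rewrite mulrDl; apply: le_trans (hnormD _ _) (lerD _ _).
Defined.

Definition bop_scale (c : R[i]) a : bop H.
Proof.
exists (fun x => c *: bfun a x) (fun x => c^* *: badj a x).
- by move=> x y; rewrite hipZl badjP badjZ.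
- by move=> d x; rewrite bfunZ !scalerA mulrC.
- have [C aC] := bfun_bounded a; exists (complex.Re `|c| * C) => x.
  by rewrite hnormZ -mulrA ler_wpM2l //; exact: (Re_le (z := 0)).
Defined.

Definition bop_mul a b : bop H.
Proof.
exists (bfun a \o bfun b) (badj b \o badj a) => /=.
- by move=> x y; rewrite !badjP.
- by move=> c x; rewrite !bfunZ.
- have [C aC] := bfun_bounded a; have [D bD] := bfun_bounded b; exists (`|C| * D) => x.
  apply: le_trans (aC _) _; rewrite -mulrA.
  apply: (@le_trans _ _ (`|C| * hnorm (bfun b x))).
    by rewrite ler_wpM2r ?hnorm_ge0 // ler_norm.
  by rewrite ler_wpM2l.
Defined.

Definition bop_star a : bop H.
Proof.
exists (badj a) (bfun a).
- exact: badjPl.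
- exact: badjZ.
- by have [C aC] := bfun_bounded a; exists C; exact: badj_le.
Defined.

HB.instance Definition _ := gen_eqMixin (bop H).
HB.instance Definition _ := gen_choiceMixin (bop H).

Fact bop_addA : associative bop_add.
Proof. by move=> a b c; apply: bop_ext => x /=; rewrite addrA. Qed.
Fact bop_addC : commutative bop_add.
Proof. by move=> a b; apply: bop_ext => x /=; rewrite addrC. Qed.
Fact bop_add0 : left_id bop_zero bop_add.
Proof. by move=> a; apply: bop_ext => x /=; rewrite add0r. Qed.
Fact bop_addN : left_inverse bop_zero (bop_scale (-1)) bop_add.
Proof. by move=> a; apply: bop_ext => x /=; rewrite scaleN1r addNr. Qed.

HB.instance Definition _ :=
  GRing.isZmodule.Build (bop H) bop_addA bop_addC bop_add0 bop_addN.

Fact bop_scaleA c d a : bop_scale c (bop_scale d a) = bop_scale (c * d) a.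
Proof. by apply: bop_ext => x /=; rewrite scalerA. Qed.
Fact bop_scale1 : left_id 1 bop_scale.
Proof. by move=> a; apply: bop_ext => x /=; rewrite scale1r. Qed.
Fact bop_scaleDr : right_distributive bop_scale +%R.
Proof. by move=> c a b; apply: bop_ext => x /=; rewrite scalerDr. Qed.
Fact bop_scaleDl a : {morph bop_scale^~ a : c d / c + d}.
Proof. by move=> c d; apply: bop_ext => x /=; rewrite scalerDl. Qed.

HB.instance Definition _ := GRing.Zmodule_isLmodule.Build R[i] (bop H)
  bop_scaleA bop_scale1 bop_scaleDr bop_scaleDl.

Let unit_values a : set R := [set hnorm (bfun a x) | x in [set x | hnorm x <= 1]].

Definition bnorm a : R := sup (unit_values a).

Let unit_values_has_sup a : has_sup (unit_values a).
Proof.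
have [C aC] := bfun_bounded a; split.
  by exists (hnorm (bfun a 0)); exists 0 => //=; rewrite hnorm0 ler01.
exists `|C| => _ [x /= x1 <-]; apply: le_trans (aC x) _.
have := ler_norm C; have := hnorm_ge0 x; have := normr_ge0 C; nra.
Qed.

Lemma bnorm_le a (C : R) : 0 <= C ->
  (forall x, hnorm (bfun a x) <= C * hnorm x) -> bnorm a <= C.
Proof.
move=> C0 aC; apply: ge_sup; first by have [] := unit_values_has_sup a.
move=> _ [x /= x1 <-]; apply: le_trans (aC x) _.
by rewrite ler_piMr.
Qed.

Lemma bnorm_ge0 a : 0 <= bnorm a.
Proof.
apply: le_trans (hnorm_ge0 (bfun a 0)) _; apply: sup_upper_bound => //.
by exists 0 => //=; rewrite hnorm0 ler01.
Qed.

Lemma hnorm_bfun a x : hnorm (bfun a x) <= bnorm a * hnorm x.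
Proof.
have [x0|x0] := eqVneq (hnorm x) 0.
  by rewrite (hnorm_eq0 x0) bfun0 !hnorm0 mulr0.
have x_gt0 : 0 < hnorm x by rewrite lt_def x0 hnorm_ge0.
pose c : R[i] := ((hnorm x)^-1)%:C%C.
have cN : complex.Re `|c| = (hnorm x)^-1.
  by rewrite ger0_norm // -[0](rmorph0 (real_complex R)) lecR invr_ge0 hnorm_ge0.
rewrite mulrC -ler_pdivrMl // -cN -hnormZ -bfunZ.
apply: sup_upper_bound => //; exists (c *: x) => //=.
by rewrite hnormZ cN mulVf.
Qed.

Fact bnormD a b : (bnorm (a + b))%:C%C <= (bnorm a)%:C%C + (bnorm b)%:C%C :> R[i].
Proof.
rewrite -rmorphD lecR; apply: bnorm_le => [|x /=]; first by rewrite addr_ge0 ?bnorm_ge0.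
by rewrite mulrDl; apply: le_trans (hnormD _ _) (lerD (hnorm_bfun _ _) (hnorm_bfun _ _)).
Qed.

Let bnormZ_le (c : R[i]) a : bnorm (c *: a) <= complex.Re `|c| * bnorm a.
Proof.
have c0 : 0 <= complex.Re `|c| by exact: (Re_le (z := 0)).
apply: bnorm_le => [|x /=]; first by rewrite mulr_ge0 ?bnorm_ge0.
by rewrite hnormZ -mulrA ler_wpM2l // hnorm_bfun.
Qed.

Fact bnorm_eq0 a : (bnorm a)%:C%C = 0 :> R[i] -> a = 0.
Proof.
move=> /(@complexI _ _ 0) a0; apply: bop_ext => x; apply: hnorm_eq0; apply/eqP.
by rewrite eq_le hnorm_ge0 andbT; have := hnorm_bfun a x; rewrite a0 mul0r.
Qed.

Fact bnormZ (c : R[i]) a : (bnorm (c *: a))%:C%C = `|c| * (bnorm a)%:C%C :> R[i].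
Proof.
rewrite -[X in X * _]ge0_ReK // -rmorphM; congr (_%:C%C).
apply/eqP; rewrite eq_le; apply/andP; split; first exact: bnormZ_le.
have [->|c0] := eqVneq c 0; first by rewrite normr0 mul0r bnorm_ge0.
have := bnormZ_le c^-1 (c *: a); rewrite scalerA mulVf // scale1r normfV.
have c_gt0 : 0 < complex.Re `|c| by rewrite -ltcR ge0_ReK // normr_gt0.
have -> : complex.Re `|c|^-1 = (complex.Re `|c|)^-1.
  by apply: complexI; rewrite [RHS](fmorphV (real_complex R)) !ge0_ReK ?invr_ge0.
by rewrite ler_pdivlMl.
Qed.

HB.instance Definition _ := Lmodule_isNormed.Build R[i] (bop H) bnormD bnormZ bnorm_eq0.

Lemma nrm_bop a : nrm a = bnorm a.
Proof. by []. Qed.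

End BoundedOperators.

(** * Completeness and the C*-identity for bounded operators *)

Section BoundedOperatorsComplete.
Context {R : realType} {H : hilbert R}.
Implicit Types (a b : bop H) (x y : H).

Lemma bfun_sub a b x : bfun (a - b) x = bfun a x - bfun b x.
Proof. by rewrite /= scaleN1r. Qed.

Lemma bop_pointwise_lim (v : nat -> bop H) :
  (forall n, bnorm (v n.+1 - v n) <= 2^-1 ^+ n) ->
  exists T : H -> H, forall x n, hnorm (T x - bfun (v n) x) <= 2 * 2^-1 ^+ n * hnorm x.
Proof.
move=> v_step.
suff /choice [T TP] : forall x, exists l, forall n,
  hnorm (l - bfun (v n) x) <= 2 * 2^-1 ^+ n * hnorm x by exists T.
move=> x; have [x0|x0] := eqVneq (hnorm x) 0.
  by exists 0 => n; rewrite x0 (hnorm_eq0 x0) bfun0 subrr hnorm0 mulr0.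
have x_gt0 : 0 < hnorm x by rewrite lt_def x0 hnorm_ge0.
have Re_real (r : R) : 0 <= r -> complex.Re `|r%:C%C : R[i]| = r.
  by move=> r0; rewrite ger0_norm ?ler0c.
(* Normalizing x brings the steps down to the bound 2^-n required by [hip_complete]. *)
pose c := (hnorm x)^-1; have c0 : 0 <= c by rewrite invr_ge0 ltW.
have cx : hnorm (c%:C%C *: x) = 1 by rewrite hnormZ Re_real // mulVf.
have [n|l lP] := @hip_complete _ H (fun n => bfun (v n) (c%:C%C *: x)).
  rewrite -bfun_sub; apply: le_trans (hnorm_bfun _ _) _.
  by rewrite cx mulr1; exact: v_step.
exists ((hnorm x)%:C%C *: l) => n.
have -> : bfun (v n) x = (hnorm x)%:C%C *: bfun (v n) (c%:C%C *: x).
  by rewrite -bfunZ scalerA -rmorphM /= mulfV // scale1r.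
by rewrite -scalerBr hnormZ Re_real ?hnorm_ge0 // mulrC ler_wpM2r ?hnorm_ge0 //; exact: lP.
Qed.

Lemma bnorm_star a : bnorm (bop_star a) = bnorm a.
Proof.
have le_star b : bnorm (bop_star b) <= bnorm b.
  by apply: bnorm_le (bnorm_ge0 _) _; apply: badj_le; exact: hnorm_bfun.
have starK b : bop_star (bop_star b) = b by exact: bop_ext.
apply/eqP; rewrite eq_le; apply/andP; split; first exact: le_star.
by rewrite -{1}(starK a) le_star.
Qed.

Lemma bop_starB a b : bop_star (a - b) = bop_star a - bop_star b.
Proof.
apply: bop_ext => x; rewrite bfun_sub /=; congr (_ + _).
by rewrite rmorphN rmorph1 scaleN1r.
Qed.

(** The adjoint of the pointwise limit is the pointwise limit of the adjoints: both sequences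
    converge at the same rate, so the adjoint relation survives. *)
Lemma bop_geometric_lim (v : nat -> bop H) :
  (forall n, bnorm (v n.+1 - v n) <= 2^-1 ^+ n) ->
  exists a, forall n, bnorm (a - v n) <= 2 * 2^-1 ^+ n.
Proof.
move=> v_step; have [T TP] := bop_pointwise_lim v_step.
have [|S SP] := @bop_pointwise_lim (fun n => bop_star (v n)).
  by move=> n; rewrite -bop_starB bnorm_star.
have p0 n : 0 <= 2^-1 ^+ n :> R by rewrite exprn_ge0 ?invr_ge0.
have adj_le x y : hip (T x) y - hip x (S y) <= 0 /\ hip x (S y) - hip (T x) y <= 0.
  have est n : hip (T x) y - hip x (S y) =
      hip (T x - bfun (v n) x) y - hip x (S y - badj (v n) y).
    by rewrite hipBl hipBr badjP opprB addrA subrK.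
  have bnd n : hnorm (T x - bfun (v n) x) * hnorm y + hnorm x * hnorm (S y - badj (v n) y)
      <= 4 * hnorm x * hnorm y * 2^-1 ^+ n.
    have := TP x n; have := SP y n => /= h1 h2; have := hnorm_ge0 x; have := hnorm_ge0 y.
    by move: h1 h2 (p0 n); nra.
  split; apply: (@le0_of_half_exp _ _ (4 * hnorm x * hnorm y)) => n;
    apply: le_trans (bnd n).
    rewrite (est n); have := cauchy_schwarz (T x - bfun (v n) x) y.
    by have := cauchy_schwarz (- x) (S y - badj (v n) y); rewrite hipNl hnormN; lra.
  rewrite -opprB (est n) opprB; have := cauchy_schwarz (- (T x - bfun (v n) x)) y.
  by have := cauchy_schwarz x (S y - badj (v n) y); rewrite hipNl hnormN; lra.
have T_adj x y : hip (T x) y = hip x (S y).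
  by have [] := adj_le x y; lra.
have T_scale (c : R[i]) x : T (c *: x) = c *: T x.
  apply/eqP; rewrite -subr_eq0; apply/eqP/hnorm_eq0/eqP; rewrite eq_le hnorm_ge0 andbT.
  apply: (@le0_of_half_exp _ _ (4 * complex.Re `|c| * hnorm x)) => n.
  have -> : T (c *: x) - c *: T x =
      (T (c *: x) - bfun (v n) (c *: x)) - c *: (T x - bfun (v n) x).
    by rewrite bfunZ scalerBr opprB addrA subrK.
  apply: le_trans (hnormB _ _) _; rewrite hnormZ.
  have := TP (c *: x) n; have := TP x n; rewrite hnormZ.
  have c0 : 0 <= complex.Re `|c| by exact: (Re_le (z := 0)).
  by move: c0 (p0 n) (hnorm_ge0 x); nra.
have T_bounded : exists C, forall x, hnorm (T x) <= C * hnorm x.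
  exists (2 + bnorm (v 0)) => x; rewrite -[T x](subrK (bfun (v 0) x)).
  apply: le_trans (hnormD _ _) _; have := TP x 0; have := hnorm_bfun (v 0) x.
  by rewrite expr0; lra.
exists (Bop T_adj T_scale T_bounded) => n; apply: bnorm_le => [|x].
  by have := p0 n; lra.
by rewrite bfun_sub; exact: TP.
Qed.

Lemma bop_complete (F : set_system (bop H)) : ProperFilter F -> cauchy F -> cvg F.
Proof.
move=> FF /cauchyP F_cauchy.
have p0 n : 0 < 2^-1 ^+ n :> R by rewrite exprn_gt0 ?invr_gt0.
have posC (e : R) : 0 < e -> 0 < e%:C%C :> R[i].
  by rewrite -[X in _ -> X < _](rmorph0 (real_complex R)) ltcR.
have ballE a (e : R) b : ball a (e%:C%C : R[i]) b -> bnorm (a - b) < e.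
  by rewrite -ball_normE /= nrmE ltcR.
(* Balls belonging to a common filter meet, so these centres form a geometric sequence, whose limit
   is the limit of [F]. *)
have /choice [v vP] : forall n, exists a, F (ball a ((4^-1 * 2^-1 ^+ n)%:C%C : R[i])).
  by move=> n; apply: F_cauchy; apply: posC; rewrite mulr_gt0 ?invr_gt0.
have bnormBC a b : bnorm (a - b) = bnorm (b - a).
  by rewrite -!nrm_bop -nrmN opprB.
have bnorm_dist a b c : bnorm (a - c) <= bnorm (a - b) + bnorm (b - c).
  by rewrite -!nrm_bop -[a - c](_ : (a - b) + (b - c) = _) ?nrmD // addrA subrK.
have v_step n : bnorm (v n.+1 - v n) <= 2^-1 ^+ n.
  have [b [/ballE b1 /ballE b2]] := filter_ex (filterI (vP n.+1) (vP n)).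
  apply: le_trans (bnorm_dist _ b _) _; rewrite (bnormBC b).
  by move: b1 b2 (p0 n); rewrite exprS; lra.
have [a aP] := bop_geometric_lim v_step.
apply/cvg_ex; exists a; apply/cvgrPdist_lt => e e0.
have eE : e = (complex.Re e)%:C%C by rewrite ge0_ReK // ltW.
have [|n nP] := @half_exp_small R (complex.Re e / 4).
  by apply: divr_gt0 => //; rewrite -ltcR -eE.
apply: filterS (vP n) => b /ballE vb; rewrite nrmE eE ltcR.
apply: le_lt_trans (bnorm_dist _ (v n) _) _.
by move: vb (aP n) (p0 n); lra.
Qed.

HB.instance Definition _ := Uniform_isComplete.Build (bop H) bop_complete.

Fact bop_mulA : associative (@bop_mul R H).
Proof. by move=> a b c; apply: bop_ext. Qed.

Fact bop_mulDl : left_distributive (@bop_mul R H) +%R.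
Proof. by move=> a b c; apply: bop_ext. Qed.

Fact bop_mulDr : right_distributive (@bop_mul R H) +%R.
Proof. by move=> a b c; apply: bop_ext => x /=; rewrite bfunD. Qed.

Fact bop_mulZl (c : R[i]) a b : bop_mul (c *: a) b = c *: bop_mul a b.
Proof. by apply: bop_ext. Qed.

Fact bop_mulZr (c : R[i]) a b : bop_mul a (c *: b) = c *: bop_mul a b.
Proof. by apply: bop_ext => x /=; rewrite bfunZ. Qed.

Fact bop_starK : involutive (@bop_star R H).
Proof. by move=> a; apply: bop_ext. Qed.

Fact bop_starD : {morph @bop_star R H : a b / a + b}.
Proof. by move=> a b; apply: bop_ext. Qed.

Fact bop_starZ (c : R[i]) a : bop_star (c *: a) = c^* *: bop_star a.
Proof. by apply: bop_ext. Qed.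

Fact bop_starM a b : bop_star (bop_mul a b) = bop_mul (bop_star b) (bop_star a).
Proof. by apply: bop_ext. Qed.

Lemma bnormM a b : bnorm (bop_mul a b) <= bnorm a * bnorm b.
Proof.
apply: bnorm_le => [|x /=]; first by rewrite mulr_ge0 ?bnorm_ge0.
apply: le_trans (hnorm_bfun _ _) _; rewrite -mulrA ler_wpM2l ?bnorm_ge0 //.
exact: hnorm_bfun.
Qed.

Fact bop_norm_mul a b : `|bop_mul a b| <= `|a| * `|b|.
Proof. by rewrite !nrmE -rmorphM lecR bnormM. Qed.

Fact bop_norm_star_mul a : `|bop_mul (bop_star a) a| = `|a| ^+ 2.
Proof.
rewrite !nrmE -rmorphXn; congr (_%:C%C); apply/eqP; rewrite eq_le; apply/andP; split.
  by apply: le_trans (bnormM _ _) _; rewrite bnorm_star expr2.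
(* Lower bound: |a x|^2 = <x, a^* a x> <= |a^* a| |x|^2. *)
set s := bop_mul _ _; have s0 := bnorm_ge0 s.
rewrite -[leRHS](sqr_sqrtr s0) ler_pXn2r ?nnegrE ?sqrtr_ge0 ?bnorm_ge0 //.
apply: bnorm_le => [|x]; first exact: sqrtr_ge0.
rewrite -(ler_pXn2r (ltn0Sn 1)) ?nnegrE ?mulr_ge0 ?sqrtr_ge0 ?hnorm_ge0 //.
rewrite [leLHS]sqr_hnorm exprMn (sqr_sqrtr s0) badjP.
apply: le_trans (cauchy_schwarz _ _) _; rewrite mulrC expr2 mulrA.
by rewrite ler_wpM2r ?hnorm_ge0 //; exact: hnorm_bfun s x.
Qed.

HB.instance Definition _ := isCStarAlgebra.Build R (bop H)
  bop_mulA bop_mulDl bop_mulDr bop_mulZl bop_mulZr bop_starK bop_starD bop_starZ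
  bop_starM bop_norm_mul bop_norm_star_mul.

End BoundedOperatorsComplete.

(** * Square-summable functions *)

Section SquareSummable.
Context {R : realType} {X : choiceType}.
Implicit Types (x y z : X -> R[i]^o) (F G : {fset X}).

Definition cdot (a b : R[i]) : R :=
  complex.Re a * complex.Re b + complex.Im a * complex.Im b.

Definition fdot F x y : R := \sum_(i <- F) cdot (x i) (y i).

Definition l2_bounded x : Prop := exists C, forall F, fdot F x x <= C.

Lemma cdotZl (c a b : R[i]) : cdot (c * a) b = cdot a (c^* * b).
Proof. by case: c a b => [? ?] [? ?] [? ?]; rewrite /cdot /=; ring. Qed.

Lemma cdot_ge0 (a : R[i]) : 0 <= cdot a a.
Proof. by rewrite addr_ge0 // -expr2 sqr_ge0. Qed.

Lemma fdot_ge0 F x : 0 <= fdot F x x.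
Proof. by apply: sumr_ge0 => i _; exact: cdot_ge0. Qed.

Lemma fdotC F x y : fdot F x y = fdot F y x.
Proof. by apply: eq_bigr => i _; rewrite /cdot mulrC [complex.Im _ * _]mulrC. Qed.

Lemma fdotDr F x y z : fdot F x (y + z) = fdot F x y + fdot F x z.
Proof.
rewrite /fdot -big_split; apply: eq_bigr => i _ /=; rewrite /cdot fctE.
by case: (y i) (z i) => [? ?] [? ?] /=; ring.
Qed.

Lemma fdotZl (c : R[i]) F x y : fdot F (c *: x) y = fdot F x (c^* *: y).
Proof. by apply: eq_bigr => i _; exact: cdotZl. Qed.

Lemma fdotZr_real (r : R) F x y : fdot F x (r%:C%C *: y) = r * fdot F x y.
Proof.
rewrite /fdot mulr_sumr; apply: eq_bigr => i _; rewrite /cdot fctE /=.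
by case: (y i) => [? ?] /=; ring.
Qed.

Lemma fdotZ (c : R[i]) F x : fdot F (c *: x) (c *: x) = complex.Re `|c| ^+ 2 * fdot F x x.
Proof.
rewrite fdotZl scalerA mulrC -normCK -fdotZr_real rmorphXn.
by congr (fdot _ _ (_ *: _)).
Qed.

Lemma fdot_sqrD F x y : fdot F (x + y) (x + y) <= 2 * fdot F x x + 2 * fdot F y y.
Proof.
rewrite /fdot !mulr_sumr -big_split; apply: ler_sum => i _ /=; rewrite /cdot fctE.
case: (x i) (y i) => [a b] [c d] /=.
by have := sqr_ge0 (a - c); have := sqr_ge0 (b - d); nra.
Qed.

(** Reduces convergence of mixed sums to that of sums of squares, which are monotone in [F]. *)
Lemma fdot_polar F x y :
  fdot F x y = 4^-1 * (fdot F (x + y) (x + y) - fdot F (x - y) (x - y)).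
Proof.
rewrite /fdot -sumrB mulr_sumr; apply: eq_bigr => i _ /=; rewrite /cdot !fctE.
by case: (x i) (y i) => [a b] [c d] /=; field.
Qed.

Lemma fdot_mono F G x : (F `<=` G)%fset -> fdot F x x <= fdot G x x.
Proof.
move=> FG; rewrite /fdot.
rewrite (eq_big_seq (fun i => if i \in F then cdot (x i) (x i) else 0)); last first.
  by move=> i ->.
rewrite (big_fset_incl _ FG) => [|i _ /negbTE -> //].
by apply: ler_sum => i _; case: ifP => _ //; exact: cdot_ge0.
Qed.

Lemma l2_submod_closed : submod_closed [pred x : X -> R[i]^o | `[< l2_bounded x >]].
Proof.
split.
  apply/asboolP; exists 0 => F; rewrite /fdot big1 // => i _.
  by rewrite /cdot /= !mul0r addr0.
move=> c x y /asboolP [C xC] /asboolP [D yD]; apply/asboolP.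
exists (2 * (complex.Re `|c| ^+ 2 * C) + 2 * D) => F.
apply: le_trans (fdot_sqrD _ _ _) _; rewrite fdotZ.
rewrite lerD // ler_wpM2l // ler_wpM2l //; first exact: sqr_ge0.
Qed.

Definition l2_pred : {pred X -> R[i]^o} := [pred x : X -> R[i]^o | `[< l2_bounded x >]].

HB.instance Definition _ :=
  GRing.isSubmodClosed.Build R[i] (X -> R[i]^o) l2_pred l2_submod_closed.

Record l2 := L2 { l2val :> X -> R[i]^o; l2valP : l2val \in l2_pred }.

HB.instance Definition _ := [isSub for l2val].
HB.instance Definition _ := [Choice of l2 by <:].
HB.instance Definition _ := [SubChoice_isSubLmodule of l2 by <:].

Lemma l2_has_bound (x : l2) : l2_bounded x.
Proof. by have /asboolP := l2valP x. Qed.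

End SquareSummable.
Arguments l2 R X : clear implicits.

Section SquareSummableInnerProduct.
Context {R : realType} {X : choiceType}.
Implicit Types (x y z : l2 R X) (F G : {fset X}).

Local Notation totally := (@summability.totally X).
Local Existing Instance summability.totally_filter.

Lemma fdot_cvg_square x : cvg (fdot F x x @[F --> totally]) /\
  forall F, fdot F x x <= lim (fdot G x x @[G --> totally]).
Proof.
have [C xC] := l2_has_bound x; pose S : set R := range (fun F => fdot F x x).
have S_sup : has_sup S.
  by split; [exists (fdot fset0 x x), fset0 | exists C => _ [F _ <-]].
have x_cvg : fdot F x x @[F --> totally] --> sup S.
  apply/cvgrPdist_lt => e e0; have [_ [F _ <-] FS] := sup_adherent e0 S_sup.
  exists F => // G /= FG; have := fdot_mono x FG.
  have : fdot G x x <= sup S by apply: sup_upper_bound => //; exists G.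
  by move=> h1 h2; rewrite ger0_norm; lra.
split; first by apply/cvg_ex; exists (sup S).
by move=> F; rewrite (cvg_lim _ x_cvg) //; apply: sup_upper_bound => //; exists F.
Qed.

Definition l2dot x y : R := lim (fdot F x y @[F --> totally]).

Lemma l2dot_cvg x y : fdot F x y @[F --> totally] --> l2dot x y.
Proof.
suff : cvg (fdot F x y @[F --> totally]) by [].
have /cvg_ex [a xa] := (fdot_cvg_square (x + y)).1.
have /cvg_ex [b xb] := (fdot_cvg_square (x - y)).1.
apply/cvg_ex; exists (4^-1 * (a - b)).
under eq_fun do rewrite fdot_polar.
exact: cvgM (cvg_cst _) (cvgB xa xb).
Qed.

Lemma l2dot_eq x y (a : R) : fdot F x y @[F --> totally] --> a -> l2dot x y = a.
Proof. by move=> xya; apply: cvg_lim. Qed.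

Lemma l2dotC x y : l2dot x y = l2dot y x.
Proof. by apply: l2dot_eq; under eq_fun do rewrite fdotC; exact: l2dot_cvg. Qed.

Lemma l2dotDr x y z : l2dot x (y + z) = l2dot x y + l2dot x z.
Proof.
apply: l2dot_eq; under eq_fun do rewrite [_ (y + z)]/= fdotDr.
by apply: cvgD; exact: l2dot_cvg.
Qed.

Lemma l2dotZl (c : R[i]) x y : l2dot (c *: x) y = l2dot x (c^* *: y).
Proof. by apply: l2dot_eq; under eq_fun do rewrite fdotZl; exact: l2dot_cvg. Qed.

Lemma l2dotZr_real (r : R) x y : l2dot x (r%:C%C *: y) = r * l2dot x y.
Proof.
apply: l2dot_eq; under eq_fun do rewrite fdotZr_real.
exact: cvgM (cvg_cst _) (@l2dot_cvg x y).
Qed.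

Lemma fdot_le_l2dot F x : fdot F x x <= l2dot x x.
Proof. exact: (fdot_cvg_square x).2. Qed.

Lemma l2dot_le (C : R) x : (forall F, fdot F x x <= C) -> l2dot x x <= C.
Proof. by move=> xC; apply: (cvgr_to_le (@l2dot_cvg x x)); exact: nearW. Qed.

Lemma l2dot_ge0 x : 0 <= l2dot x x.
Proof. exact: le_trans (fdot_ge0 fset0 _) (fdot_le_l2dot _ _). Qed.

Lemma cdot_le_l2dot x i : cdot (x i) (x i) <= l2dot x x.
Proof.
by have := fdot_le_l2dot [fset i]%fset x; rewrite /fdot big_seq_fset1.
Qed.

Lemma l2dot_eq0 x : l2dot x x = 0 -> x = 0.
Proof.
move=> x0; apply: val_inj; apply/funext => i /=.
have := cdot_le_l2dot x i; rewrite x0 /cdot; case: (x i) => [a b] /= ab.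
have a0 : a = 0 by nra.
have b0 : b = 0 by nra.
by rewrite a0 b0.
Qed.

Definition l2_prehilbert : prehilbert R :=
  Prehilbert l2dotC l2dotDr l2dotZl l2dotZr_real l2dot_ge0 l2dot_eq0.

End SquareSummableInnerProduct.
Arguments l2_prehilbert R X : clear implicits.

Lemma real_geometric_lim {R : realType} (u : nat -> R) :
  (forall n, `|u n.+1 - u n| <= 2^-1 ^+ n) ->
  exists l : R, u n @[n --> \oo] --> l.
Proof.
move=> u_step.
have u_dist := geometric_telescope (@normr0 _ R) (@ler_normD _ R) u_step.
suff /cauchy_cvg /cvg_ex [l ul] : cauchy (u @ \oo) by exists l.
apply: cauchy_exP => e e0.
have [|n nP] := @half_exp_small R (e / 2); first by rewrite divr_gt0.
exists (u n), n => // m /= nm; rewrite -ball_normE /= distrC.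
by apply: le_lt_trans (u_dist _ _ nm) _; lra.
Qed.

Section SquareSummableComplete.
Context {R : realType} {X : choiceType}.

Local Notation H := (l2_prehilbert R X).

Lemma l2_complete (u : nat -> H) : (forall n, hnorm (u n.+1 - u n) <= 2^-1 ^+ n) ->
  exists l, forall n, hnorm (l - u n) <= 2 * 2^-1 ^+ n.
Proof.
move=> u_step; have p0 n : 0 <= 2^-1 ^+ n :> R by rewrite exprn_ge0 ?invr_ge0.
have u_dist := geometric_telescope (hnorm0 (H := H)) (@hnormD _ H) u_step.
have coord_le (z : R[i]) (e : R) : 0 <= e -> cdot z z <= e ^+ 2 ->
    `|complex.Re z| <= e /\ `|complex.Im z| <= e.
  move=> e0; rewrite /cdot !ler_norml; move: (complex.Re z) (complex.Im z) => a b ab.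
  by split; apply/andP; split; nra.
have subE (x y : H) i : (x - y : H) i = x i - y i by [].
have u_coord i n : `|complex.Re (u n.+1 i) - complex.Re (u n i)| <= 2^-1 ^+ n /\
    `|complex.Im (u n.+1 i) - complex.Im (u n i)| <= 2^-1 ^+ n.
  have -> : complex.Re (u n.+1 i) - complex.Re (u n i) = complex.Re ((u n.+1 - u n : H) i).
    by rewrite subE; case: (u n.+1 i) (u n i) => [? ?] [? ?].
  have -> : complex.Im (u n.+1 i) - complex.Im (u n i) = complex.Im ((u n.+1 - u n : H) i).
    by rewrite subE; case: (u n.+1 i) (u n i) => [? ?] [? ?].
  apply: coord_le => //; apply: le_trans (cdot_le_l2dot (u n.+1 - u n) i) _.
  rewrite -[leLHS](sqr_hnorm (u n.+1 - u n)).
  by rewrite ler_pXn2r ?nnegrE ?hnorm_ge0.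
have /choice [lre lreP] := fun i => real_geometric_lim (fun n => (u_coord i n).1).
have /choice [lim_ limP] := fun i => real_geometric_lim (fun n => (u_coord i n).2).
pose l : X -> R[i]^o := fun i => Complex (lre i) (lim_ i).
(* As in Fatou's lemma: on a fixed finite [F] the bound passes to the coordinatewise limit in m, and
   it is uniform in [F]. *)
have l_dist n F : fdot F (l - u n : X -> R[i]^o) (l - u n : X -> R[i]^o)
    <= (2 * 2^-1 ^+ n) ^+ 2.
  have : fdot F (u m - u n : H) (u m - u n : H) @[m --> \oo] -->
      fdot F (l - u n : X -> R[i]^o) (l - u n : X -> R[i]^o).
    have ReB (z w : R[i]) : complex.Re (z - w) = complex.Re z - complex.Re w.
      by case: z w => [? ?] [? ?].
    have ImB (z w : R[i]) : complex.Im (z - w) = complex.Im z - complex.Im w.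
      by case: z w => [? ?] [? ?].
    have re_cvg i : complex.Re ((u m - u n : H) i) @[m --> \oo] -->
        complex.Re (l i - u n i).
      under eq_fun do rewrite subE ReB.
      by rewrite ReB; apply: cvgB; [exact: lreP | exact: cvg_cst].
    have im_cvg i : complex.Im ((u m - u n : H) i) @[m --> \oo] -->
        complex.Im (l i - u n i).
      under eq_fun do rewrite subE ImB.
      by rewrite ImB; apply: cvgB; [exact: limP | exact: cvg_cst].
    apply: cvg_big => [|i _]; first exact: add_continuous.
    exact: cvgD (cvgM (re_cvg i) (re_cvg i)) (cvgM (im_cvg i) (im_cvg i)).
  move=> /cvgr_to_le; apply; exists n => // m /= nm.
  apply: (le_trans (fdot_le_l2dot F (u m - u n : l2 R X))); rewrite -[leLHS](sqr_hnorm (u m - u n)).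
  by rewrite ler_pXn2r ?nnegrE ?hnorm_ge0 ?mulr_ge0 //; exact: u_dist.
have l_l2 : l \in l2_pred.
  (* Write l = (l - u_0) + u_0; the 4 is the squared distance bound at n = 0. *)
  apply/asboolP; have [C uC] := l2_has_bound (u 0); exists (2 * 4 + 2 * C) => F.
  have := fdot_sqrD F (l - u 0 : X -> R[i]^o) (u 0); rewrite subrK.
  have := l_dist 0 F; have := uC F; rewrite expr0 mulr1; lra.
exists (L2 l_l2 : H) => n; rewrite -(ler_pXn2r (ltn0Sn 1)) ?nnegrE ?hnorm_ge0 ?mulr_ge0 //.
by rewrite sqr_hnorm; apply: l2dot_le => F; exact: l_dist.
Qed.

Definition l2_hilbert : hilbert R := @Hilbert R H l2_complete.

End SquareSummableComplete.
Arguments l2_hilbert R X : clear implicits.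

(** * Operators defined by partial injections *)

Section PartialInjections.
Context {R : realType} {X : choiceType}.

(** With a relation in place of a partial function, inversion is a swap of arguments. In
    [prel p y x], the new value at y is read off at x. *)
Record pinj := Pinj {
  prel : X -> X -> Prop;
  prel_funl : forall y x x', prel y x -> prel y x' -> x = x';
  prel_funr : forall y y' x, prel y x -> prel y' x -> y = y'
}.
Implicit Types (p q : pinj) (x y z : X) (h k : X -> R[i]^o) (F : {fset X}).

Definition pinv p : pinj := Pinj (prel := fun x y => prel p y x)
  (fun x y y' => @prel_funr p y y' x) (fun x x' y => @prel_funl p y x x').

Definition pfun p y : option X :=
  if pselect (exists x, prel p y x) is left e then Some (projT1 (cid e)) else None.

Lemma pfunP p y x : pfun p y = Some x <-> prel p y x.
Proof.
rewrite /pfun; case: pselect => [e|ne]; last by split=> // yx; case: ne; exists x.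
have ex := projT2 (cid e); split=> [[<-] //|yx].
by congr Some; exact: prel_funl ex yx.
Qed.

Definition pull p h : X -> R[i]^o := fun y => oapp h 0 (pfun p y).

Lemma pull_some p h y x : prel p y x -> pull p h y = h x.
Proof. by move=> /pfunP yx; rewrite /pull yx. Qed.

Lemma pull_none p h y : ~ (exists x, prel p y x) -> pull p h y = 0.
Proof. by rewrite /pull /pfun; case: pselect. Qed.

(** Distinct points read from distinct points, so the sum is merely reindexed; contractivity of
    [lpull] follows. *)
Lemma fdot_pull p h F : fdot F (pull p h) (pull p h) =
  fdot (seq_fset tt (pmap (pfun p) F)) h h.
Proof.
have pmap_uniq' (s : seq X) : uniq s -> uniq (pmap (pfun p) s).
  elim: s => //= y s IHs /andP[ys /IHs us]; case yx: (pfun p y) => [x|] //=.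
  rewrite us andbT mem_pmap; apply: contra ys => /mapP[y' y's /esym].
  by move: yx => /pfunP yx /pfunP y'x; rewrite (prel_funr yx y'x).
rewrite /fdot [RHS](perm_big _ (seq_fset_perm _ _)) undup_id; last exact/pmap_uniq'/fset_uniq.
rewrite big_pmap; apply: eq_bigr => y _; rewrite /pull.
by case: (pfun p y) => //=; rewrite /cdot /= !mul0r addr0.
Qed.

Fact pull_l2 p (h : l2 R X) : pull p h \in l2_pred.
Proof.
by apply/asboolP; have [C hC] := l2_has_bound h; exists C => F; rewrite fdot_pull.
Qed.

Definition lpull p (h : l2 R X) : l2 R X := L2 (pull_l2 p h).

Local Notation H := (l2_hilbert R X).

Lemma l2_ext (h k : l2 R X) : (forall x, h x = k x) -> h = k.
Proof. by move=> hk; apply: val_inj; apply/funext. Qed.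

Lemma lpullD p (h k : l2 R X) : lpull p (h + k) = lpull p h + lpull p k.
Proof.
apply: l2_ext => y; rewrite /= /pull !fctE; case: (pfun p y) => //=.
by rewrite addr0.
Qed.

Lemma lpullZ p (c : R[i]) (h : l2 R X) : lpull p (c *: h) = c *: lpull p h.
Proof.
apply: l2_ext => y; rewrite /= /pull !fctE; case: (pfun p y) => //=.
by rewrite scaler0.
Qed.

Lemma lpullB p (h k : l2 R X) : lpull p (h - k) = lpull p h - lpull p k.
Proof. by rewrite -scaleN1r lpullD lpullZ scaleN1r. Qed.

Lemma lpull_some p (h : l2 R X) y x : prel p y x -> lpull p h y = h x.
Proof. exact: pull_some. Qed.

Lemma lpull_none p (h : l2 R X) y : ~ (exists x, prel p y x) -> lpull p h y = 0.
Proof. exact: pull_none. Qed.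

Lemma lpull_le p (h : l2 R X) : l2dot (lpull p h) (lpull p h) <= l2dot h h.
Proof.
by apply: l2dot_le => F; rewrite fdot_pull; exact: fdot_le_l2dot.
Qed.

Lemma lpull_pinvK p (h : l2 R X) : lpull p (lpull (pinv p) (lpull p h)) = lpull p h.
Proof.
apply: l2_ext => y; have [[x yx]|ny] := pselect (exists x, prel p y x); last first.
  by rewrite !(lpull_none _ ny).
by rewrite !(lpull_some _ yx) (lpull_some (p := pinv p) _ yx) (lpull_some _ yx).
Qed.

Lemma lpull_pinvK' p (h : l2 R X) :
  lpull (pinv p) (lpull p (lpull (pinv p) h)) = lpull (pinv p) h.
Proof.
apply: l2_ext => x; have [[y yx]|nx] := pselect (exists y, prel (pinv p) x y); last first.
  by rewrite !(lpull_none _ nx).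
by rewrite !(lpull_some _ yx) (lpull_some (p := p) _ yx) (lpull_some _ yx).
Qed.

Lemma l2dot_polar (h k : l2 R X) :
  l2dot h k = 4^-1 * (l2dot (h + k) (h + k) - l2dot (h - k) (h - k)).
Proof.
have := @hipBr _ (l2_prehilbert R X); have := @hipDl _ (l2_prehilbert R X).
have := @hipBl _ (l2_prehilbert R X) => /= Bl Dl Br.
by rewrite Bl Dl !Br !l2dotDr (l2dotC k h); field.
Qed.

Lemma eq_l2dot (h k h' k' : l2 R X) :
  (forall x, cdot (h x) (k x) = cdot (h' x) (k' x)) -> l2dot h k = l2dot h' k'.
Proof.
move=> hk; apply: l2dot_eq; rewrite (_ : (fun F => fdot F h k) = (fun F => fdot F h' k')).
  exact: l2dot_cvg.
by apply/funext => F; apply: eq_bigr => x _; exact: hk.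
Qed.

(* [lpull p] is a partial isometry with initial projection
   [lpull (pinv p) \o lpull p]; the adjunction follows by polarization. *)
Lemma lpull_adj p (h k : l2 R X) : l2dot (lpull p h) k = l2dot h (lpull (pinv p) k).
Proof.
have cdot0r (a : R[i]) : cdot a 0 = 0 by rewrite /cdot /= !mulr0 addr0.
have cdot0l (a : R[i]) : cdot 0 a = 0 by rewrite /cdot /= !mul0r addr0.
pose h1 := lpull (pinv p) (lpull p h); pose g := lpull (pinv p) k.
have -> : l2dot (lpull p h) k = l2dot (lpull p h1) (lpull p g).
  rewrite lpull_pinvK; apply: eq_l2dot => y.
  have [[x yx]|ny] := pselect (exists x, prel p y x); last first.
    by rewrite !(lpull_none _ ny) !cdot0l.
  by rewrite /g (lpull_some g yx) (lpull_some (p := pinv p) k yx).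
have -> : l2dot h g = l2dot h1 g.
  apply: eq_l2dot => x; rewrite /g /h1.
  have [[y yx]|nx] := pselect (exists y, prel (pinv p) x y); last first.
    by rewrite !(lpull_none _ nx) !cdot0r.
  by rewrite !(lpull_some _ yx) (lpull_some (p := p) h yx).
have iso (w : l2 R X) : l2dot (lpull p (lpull (pinv p) w)) (lpull p (lpull (pinv p) w)) =
    l2dot (lpull (pinv p) w) (lpull (pinv p) w).
  apply/eqP; rewrite eq_le lpull_le /=.
  by have := lpull_le (pinv p) (lpull p (lpull (pinv p) w)); rewrite lpull_pinvK'.
by rewrite l2dot_polar [RHS]l2dot_polar -lpullD -lpullB /h1 /g -lpullD -lpullB !iso.
Qed.

Fact pinj_op_bounded p : exists C : R, forall h : H, hnorm (lpull p h : H) <= C * hnorm h.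
Proof.
exists 1 => h; rewrite mul1r -(ler_pXn2r (ltn0Sn 1)) ?nnegrE ?hnorm_ge0 //.
by rewrite !sqr_hnorm; exact: lpull_le.
Qed.

Definition pinj_op p : bop H := Bop (H := H) (lpull_adj p) (lpullZ p) (pinj_op_bounded p).

Lemma cstar_pinj_op p : cstar (pinj_op p) = pinj_op (pinv p).
Proof. by apply: bop_ext. Qed.

Lemma pinj_op_mul p q r :
  (forall y z, prel r y z <-> exists2 x, prel p y x & prel q x z) ->
  pinj_op p ** pinj_op q = pinj_op r.
Proof.
move=> rE; apply: bop_ext => h; apply: l2_ext => y /=.
have [[z yz]|ny] := pselect (exists z, prel r y z).
  have /rE [x yx xz] := yz.
  by rewrite (pull_some _ yz) (pull_some _ yx) (pull_some _ xz).
rewrite (pull_none _ ny); have [[x yx]|nyx] := pselect (exists x, prel p y x).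
  rewrite (pull_some _ yx) pull_none // => -[z xz]; apply: ny; exists z.
  by apply/rE; exists x.
by rewrite pull_none.
Qed.

Lemma pinj_op_mul0 p q : (forall x y z, prel p y x -> prel q x z -> False) ->
  pinj_op p ** pinj_op q = 0.
Proof.
move=> pq0; apply: bop_ext => h; apply: l2_ext => y /=.
have [[x yx]|ny] := pselect (exists x, prel p y x); last by rewrite pull_none.
by rewrite (pull_some _ yx) pull_none // => -[z xz]; exact: pq0 yx xz.
Qed.

Lemma pinj_op_ext p q : (forall y x, prel p y x <-> prel q y x) -> pinj_op p = pinj_op q.
Proof.
move=> pq; apply: bop_ext => h; apply: l2_ext => y /=.
have [[x yx]|ny] := pselect (exists x, prel p y x).
  by rewrite (pull_some _ yx) (pull_some _ ((pq _ _).1 yx)).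
by rewrite !pull_none // => -[x /pq yx]; apply: ny; exists x.
Qed.

Lemma pinj_op_neq0 p y x : prel p y x -> pinj_op p <> 0.
Proof.
move=> yx p0; pose d : X -> R[i]^o := fun z => if z == x then 1 else 0.
have d_l2 : d \in l2_pred.
  apply/asboolP; exists 1 => F; rewrite /fdot.
  rewrite (eq_bigr (fun z => if z == x then 1 else 0)); last first.
    by move=> z _; rewrite /d /cdot; case: eqP => _ /=; rewrite !(mul0r, mulr1) addr0.
  case: (boolP (x \in F)) => xF.
    rewrite (big_fsetD1 x xF) /= eqxx big1_fset ?addr0 // => z.
    by rewrite !inE => /andP[/negbTE ->].
  rewrite big1_seq ?ler01 // => z /andP[_ zF]; case: eqP zF => [->|//].
  by rewrite (negbTE xF).
have := congr1 (fun a => bfun a (L2 d_l2 : H)) p0.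
move=> /(congr1 (fun h : l2 R X => h y)) /=; rewrite (pull_some _ yx) /d /= eqxx.
by move=> /eqP; rewrite oner_eq0.
Qed.

End PartialInjections.
Arguments pinj : clear implicits.

(** * The representation on infinite paths *)

Section Prefixes.
Context {L : ngraph}.
Implicit Types (a b c l : gpath L) (m n : multidegree).

Definition prefix_path a l : Prop := exists2 b, gsrc a = grng b & l = gcomp a b.

Lemma gcomp_inj a b a' b' : gsrc a = grng b -> gsrc a' = grng b' ->
  gdeg a = gdeg a' -> gcomp a b = gcomp a' b' -> a = a' /\ b = b'.
Proof.
move=> ab ab' aa' abE; have ab_deg := deg_comp ab.
have bb' : gdeg b' = gdeg b.
  by apply: (@mdeg_addI (gdeg a)); rewrite -ab_deg abE deg_comp // aa'.
have [u [_ u_uniq]] := factorization ab_deg.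
have u1 : u = (a, b) by apply: u_uniq.
have u2 : u = (a', b') by apply: u_uniq; split=> //=; rewrite ?abE.
by move: u2; rewrite u1 => -[-> ->].
Qed.

Lemma prefix_exists l m n : gdeg l = m + n -> exists2 a, gdeg a = m & prefix_path a l.
Proof.
move=> /factorization [[a b] [[/= ab -> am _] _]].
by exists a => //; exists b.
Qed.

Lemma prefix_uniq a a' l : prefix_path a l -> prefix_path a' l -> gdeg a = gdeg a' -> a = a'.
Proof.
by move=> [b ab ->] [b' ab' E] aa'; have [] := gcomp_inj ab ab' aa' E.
Qed.

Lemma prefix_trans a b c : prefix_path a b -> prefix_path b c -> prefix_path a c.
Proof.
move=> [u au ->] [v]; rewrite src_comp // => uv ->.
by exists (gcomp u v); [rewrite rng_comp | rewrite compA].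
Qed.

Lemma prefix_le a a' l n : prefix_path a l -> prefix_path a' l ->
  gdeg a' = gdeg a + n -> prefix_path a a'.
Proof.
move=> al a'l /prefix_exists [c ca ca']; rewrite (prefix_uniq al _ (esym ca)) //.
exact: prefix_trans ca' a'l.
Qed.

Lemma prefix_rng a l : prefix_path a l -> grng l = grng a.
Proof. by move=> [b ab ->]; rewrite rng_comp. Qed.

Lemma prefix_comp a b l : gsrc l = grng a -> prefix_path a b ->
  prefix_path (gcomp l a) (gcomp l b).
Proof.
move=> la [c ac ->]; exists c; first by rewrite src_comp.
by rewrite compA.
Qed.

Lemma prefix_comp_cancel a b l : gsrc l = grng a -> gsrc l = grng b ->
  prefix_path (gcomp l a) (gcomp l b) -> prefix_path a b.
Proof.
move=> la lb [c]; rewrite src_comp // => ac; rewrite -compA // => E.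
exists c => //; by have [] := gcomp_inj lb _ erefl E; rewrite ?rng_comp.
Qed.

Lemma deg0_id l : gdeg l = 0 -> l = gid (grng l).
Proof.
move=> l0; apply: (prefix_uniq (l := l)); last by rewrite deg_id.
  by exists (gid (gsrc l)); rewrite ?rng_id ?comp_idr.
by exists l; rewrite ?src_id ?comp_idl.
Qed.

(** An infinite path is usually a degree-preserving functor x(m, n). The segments x(0, n) determine
    it, the others being recovered by factorization. *)
Record ipath := IPath {
  iseg : multidegree -> gpath L;
  iseg_deg : forall n, gdeg (iseg n) = n;
  iseg_prefix : forall m n, prefix_path (iseg m) (iseg (m + n))
}.
Implicit Types x y z : ipath.

HB.instance Definition _ := gen_eqMixin ipath.
HB.instance Definition _ := gen_choiceMixin ipath.

Lemma ipath_ext x y : (forall n, iseg x n = iseg y n) -> x = y.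
Proof.
case: x y => [x xd xp] [y yd yp] /= /funext xy; subst y.
by congr IPath; exact: Prop_irrelevance.
Qed.

Definition irng x : vertex L := grng (iseg x 0).

Lemma iseg_rng x n : grng (iseg x n) = irng x.
Proof. by have := iseg_prefix x 0 n; rewrite add0r => /prefix_rng. Qed.

Lemma iseg0 x : iseg x 0 = gid (irng x).
Proof. exact/deg0_id/iseg_deg. Qed.

(** That is, y = l x. Only segments of degree at least d(l) are prescribed; the others are prefixes
    of these. *)
Definition extends l y x : Prop :=
  gsrc l = irng x /\ forall n, iseg y (gdeg l + n) = gcomp l (iseg x n).

Lemma extends_iseg l y x : extends l y x -> iseg y (gdeg l) = l.
Proof. by move=> [lx /(_ 0)]; rewrite addr0 iseg0 -lx comp_idr. Qed.

Lemma extends_funl l y x x' : extends l y x -> extends l y x' -> x = x'.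
Proof.
move=> [lx yx] [lx' yx']; apply: ipath_ext => n; have := yx n; rewrite yx' => E.
by have [] := gcomp_inj _ _ erefl E; rewrite ?iseg_rng.
Qed.

Lemma extends_funr l y y' x : extends l y x -> extends l y' x -> y = y'.
Proof.
move=> [lx yx] [_ y'x]; apply: ipath_ext => n.
apply: (prefix_uniq (l := iseg y (n + gdeg l))); last by rewrite !iseg_deg.
  exact: iseg_prefix.
by rewrite addrC yx -y'x addrC; exact: iseg_prefix.
Qed.

Definition extends_pinj l : pinj ipath :=
  Pinj (@extends_funl l) (@extends_funr l).

Lemma extends_total l x : gsrc l = irng x -> exists y, extends l y x.
Proof.
move=> lx; have lxn n : gsrc l = grng (iseg x n) by rewrite iseg_rng.
(* The path l x(n) has degree d(l) + n, so it is long enough to contain the segment of degree n. *)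
have /choice [y yP] : forall n, exists a,
    gdeg a = n /\ prefix_path a (gcomp l (iseg x n)).
  move=> n; have [|a] := @prefix_exists (gcomp l (iseg x n)) n (gdeg l).
    by rewrite deg_comp // iseg_deg addrC.
  by exists a.
have y_deg n := (yP n).1.
have y_prefix m n : prefix_path (y m) (y (m + n)).
  apply: (prefix_le (l := gcomp l (iseg x (m + n))) (n := n)).
  - by apply: prefix_trans (yP m).2 _; apply: prefix_comp => //; exact: iseg_prefix.
  - exact: (yP _).2.
  - by rewrite !y_deg.
exists (IPath y_deg y_prefix); split=> //= n.
apply: (prefix_uniq (l := gcomp l (iseg x (gdeg l + n)))); first exact: (yP _).2.
  by rewrite addrC; apply: prefix_comp => //; exact: iseg_prefix.
by rewrite y_deg deg_comp // iseg_deg.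
Qed.

Lemma extends_of_iseg l y : iseg y (gdeg l) = l -> exists x, extends l y x.
Proof.
move=> yl; have /choice [x xP] : forall n, exists b,
    gsrc l = grng b /\ iseg y (gdeg l + n) = gcomp l b.
  by move=> n; have := iseg_prefix y (gdeg l) n; rewrite yl => -[b lb E]; exists b.
have lx n := (xP n).1.
have x_deg n : gdeg (x n) = n.
  by apply: (@mdeg_addI (gdeg l)); rewrite -deg_comp // -(xP n).2 iseg_deg.
have x_prefix m n : prefix_path (x m) (x (m + n)).
  apply: (prefix_comp_cancel (lx m) (lx _)); rewrite -!(xP _).2 addrA.
  exact: iseg_prefix.
by exists (IPath x_deg x_prefix); split; [exact: lx | exact: (fun n => (xP n).2)].
Qed.

Lemma extends_id v y x : extends (gid v) y x <-> y = x /\ irng x = v.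
Proof.
split=> [[vx yx]|[-> xv]].
  split; last by rewrite -vx src_id.
  apply: ipath_ext => n; have := yx n; rewrite deg_id add0r => ->.
  by rewrite -[X in gcomp X]/(gid v) -(src_id v) vx -(iseg_rng x n) comp_idl.
split; first by rewrite src_id.
by move=> n; rewrite deg_id add0r -xv -(iseg_rng x n) comp_idl.
Qed.

Lemma extends_comp l (m : gpath L) y z : gsrc l = grng m ->
  extends (gcomp l m) y z <-> exists2 x, extends l y x & extends m x z.
Proof.
move=> lm; have comp x y' : extends l y' x -> extends m x z -> extends (gcomp l m) y' z.
  move=> [lx yx] [mz xz]; split=> [|n]; first by rewrite src_comp.
  by rewrite deg_comp // -addrA yx xz compA // iseg_rng.
split=> [yz|[x yx xz]]; last exact: comp yx xz.
(* Prolong z by m, then by l; uniqueness identifies the result with y. *)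
have [|x xz] := @extends_total m z; first by rewrite -(src_comp lm) yz.1.
have mx : irng x = grng m by rewrite -(extends_iseg xz) iseg_rng.
have [|y' y'x] := @extends_total l x; first by rewrite mx.
exists x => //; by rewrite (extends_funr yz (comp _ _ y'x xz)).
Qed.

End Prefixes.
Arguments ipath : clear implicits.

(** * Existence of infinite paths *)

Section InfinitePathsExist.
Context {L : ngraph} (L_no_sources : no_sources L).

(** Multiples of one degree are never cofinal, the constant sequence 1 not being finitely supported;
    adding boxes of increasing length gives cofinal degrees. *)
Definition unit_box (k : nat) : multidegree := [fsfun i in [fset i | i in iota 0 k]%fset => 1%N].

Lemma unit_boxE k i : unit_box k i = (i < k)%N.
Proof.
rewrite fsfunE in_fset /= mem_iota add0n /=.
by case: ifP.
Qed.

Fixpoint growing_path (v : vertex L) (k : nat) : gpath L :=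
  if k is k'.+1 then
    let l := growing_path v k' in
    gcomp l (projT1 (cid (L_no_sources (gsrc l) (unit_box k'))))
  else gid v.

Lemma growing_pathS v k : exists m, [/\ gsrc (growing_path v k) = grng m,
  gdeg m = unit_box k & growing_path v k.+1 = gcomp (growing_path v k) m].
Proof.
rewrite /=; case: cid => m [mr md] /=; exists m; split=> //.
Qed.

(** The box of length k' < k reaches coordinate i exactly when i < k'; truncated subtraction covers
    k <= i. *)
Lemma growing_path_deg v k i : gdeg (growing_path v k) i = (k - i.+1)%N.
Proof.
elim: k => [|k IHk]; first by rewrite /= deg_id fsfun0E.
have [m [km md ->]] := growing_pathS v k; rewrite deg_comp // md mdegD IHk unit_boxE.
by case: ltnP => ik /=; lia.
Qed.

Lemma growing_path_prefix v k j : prefix_path (growing_path v k) (growing_path v (k + j)).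
Proof.
elim: j => [|j IHj].
  by rewrite addn0; exists (gid (gsrc (growing_path v k))); rewrite ?rng_id ?comp_idr.
apply: prefix_trans IHj _; rewrite addnS.
by have [m [km _ ->]] := growing_pathS v (k + j); exists m.
Qed.

Lemma growing_path_cofinal v (n : multidegree) :
  exists k m, gdeg (growing_path v k) = n + m.
Proof.
pose k := (\max_(i <- finsupp n) (i.+1 + n i))%N.
have kP i : (n i <= k - i.+1)%N.
  case: (boolP (i \in finsupp n)) => [ni|/fsfun_dflt -> //].
  have : (i.+1 + n i <= k)%N by exact: (leq_bigmax_seq (F := fun i => (i.+1 + n i)%N)).
  lia.
exists k, [fsfun i in finsupp (gdeg (growing_path v k)) =>
  (gdeg (growing_path v k) i - n i)%N].
apply/fsfunP => i; rewrite mdegD fsfunE; case: ifP => [_|/negbT /fsfun_dflt ki].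
  by rewrite subnKC // growing_path_deg.
by have := kP i; rewrite -(growing_path_deg v) ki; lia.
Qed.

Lemma ipath_exists v : exists x : ipath L, irng x = v.
Proof.
(* Being a prefix of all late growing paths makes any two chosen segments prefixes of a common path,
   hence compatible. *)
have /choice [x xP] : forall n, exists a, gdeg a = n /\
    exists K, forall k, (K <= k)%N -> prefix_path a (growing_path v k).
  move=> n; have [K [m /prefix_exists [a an aK]]] := growing_path_cofinal v n.
  exists a; split=> //; exists K => k /subnKC <-.
  exact: prefix_trans aK (growing_path_prefix _ _ _).
have x_deg n := (xP n).1.
have x_prefix m n : prefix_path (x m) (x (m + n)).
  have [K xK] := (xP m).2; have [K' xK'] := (xP (m + n)).2.
  apply: (prefix_le (xK (K + K')%N (leq_addr _ _)) (xK' _ (leq_addl _ _)) (n := n)).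
  by rewrite !x_deg.
exists (IPath x_deg x_prefix); rewrite /irng /=.
have [K xK] := (xP 0).2; rewrite -(prefix_rng (xK K (leqnn K))).
by rewrite (prefix_rng (growing_path_prefix v 0 K)) rng_id.
Qed.

End InfinitePathsExist.

(** * Cuntz-Krieger relations for the path operators *)

Section PathRepresentation.
Context {R : realType} {L : ngraph} (L_row_finite : row_finite L).
Implicit Types (l m : gpath L) (v : vertex L).

Local Notation H := (l2_hilbert R (ipath L)).

Definition path_op l : bop H := pinj_op (extends_pinj l).

Lemma path_op_range l (h : H) (y : ipath L) :
  (bfun (path_op l ** cstar (path_op l)) h : l2 R (ipath L)) y =
  if iseg y (gdeg l) == l then (h : l2 R (ipath L)) y else 0.
Proof.
rewrite cstar_pinj_op /=; case: eqP => [/extends_of_iseg [x yx]|yl].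
  by rewrite (pull_some (p := extends_pinj l) _ yx) (pull_some (p := pinv (extends_pinj l)) _ yx).
by rewrite pull_none // => -[x /extends_iseg].
Qed.

(** Evaluated at an infinite path y with range v, only the summand of its own segment [iseg y n]
    survives. *)
Lemma path_op_sum v n :
  path_op (gid v) = \sum_(l \in paths_from v n) path_op l ** cstar (path_op l).
Proof.
rewrite fsbig_finite //=; apply: bop_ext => h; apply: l2_ext => y.
pose eval (a : bop H) : R[i]^o := (bfun a h : l2 R (ipath L)) y.
have -> : l2val (bfun (path_op (gid v)) h) y =
    if irng y == v then (h : l2 R (ipath L)) y else 0.
  case: eqP => [yv|yv] /=.
    by rewrite (@pull_some _ _ (extends_pinj (gid v)) _ y y) //; exact/extends_id.
  by rewrite pull_none // => -[x /extends_id [yx xv]]; apply: yv; rewrite yx.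
transitivity (\sum_(l <- fset_set (paths_from v n)) eval (path_op l ** cstar (path_op l))).
  under eq_big_seq => l.
    rewrite in_fset_set // => /set_mem [_ ln]; rewrite /eval path_op_range ln.
    over.
  case: eqP => [yv|yv]; last first.
    rewrite big1_seq // => l /andP[_]; rewrite in_fset_set // => /set_mem [lv _].
    by case: eqP => // yl; case: yv; rewrite -lv -yl iseg_rng.
  rewrite (bigD1_seq (iseg y n)) ?fset_uniq //=; last first.
    by rewrite in_fset_set //; apply/mem_set; split; [rewrite iseg_rng | exact: iseg_deg].
  by rewrite eqxx big1 ?addr0 // => l; rewrite eq_sym => /negbTE ->.
have evalD : {morph eval : a b / a + b} by [].
have eval0 : eval 0 = 0 by [].
exact: esym (big_morph eval evalD eval0 _ _ _).
Qed.

Lemma path_op_CK : CK_family path_op.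
Proof.
split.
- move=> l; apply: bop_ext => h; rewrite cstar_pinj_op; exact: lpull_pinvK.
- move=> v; split.
    rewrite cstar_pinj_op; apply: pinj_op_ext => y x /=.
    by split=> /extends_id [-> ?]; apply/extends_id.
  apply: pinj_op_mul => y z /=; split=> [yz|[x /extends_id [-> _] //]].
  by exists z => //; have /extends_id [_ zv] := yz; apply/extends_id.
- move=> u v uv; apply: pinj_op_mul0 => x y z /= /extends_id [_ xu] /extends_id [xz zv].
  by move: uv; rewrite -xu -zv xz eqxx.
- by move=> l m lm; apply: pinj_op_mul => y z /=; exact: extends_comp.
- move=> l m lm; apply: pinj_op_mul0 => x y z /= [lx _] /extends_iseg xm.
  by move: lm; rewrite lx -xm iseg_rng eqxx.
- move=> l; rewrite cstar_pinj_op; apply: pinj_op_mul => x z /=; split.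
    move=> /extends_id [-> /esym /extends_total [y yz]]; by exists y.
  move=> [y yx yz]; apply/extends_id; split; first exact: extends_funl yx yz.
  by rewrite yz.1.
- exact: path_op_sum.
Qed.

Lemma path_op_vertex_neq0 (L_no_sources : no_sources L) v : path_op (gid v) <> 0.
Proof.
have [x xv] := ipath_exists L_no_sources v.
by apply: (pinj_op_neq0 (p := extends_pinj (gid v)) (x := x) (y := x)); apply/extends_id.
Qed.

End PathRepresentation.

Lemma graph_algebra_vertex_neq0 (R : realType) (L : ngraph) (A : cstarAlgType R)
    (s : gpath L -> A) (v : vertex L) :
  row_finite L -> no_sources L -> is_graph_algebra s -> s (gid v) <> 0.
Proof.
move=> L_rf L_ns [_ _ univ] sv0.
have [g _ gs] := univ _ _ (path_op_CK (R := R) L_rf).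
by apply: (path_op_vertex_neq0 (R := R) L_ns (v := v)); rewrite -gs sv0 linear0.
Qed.

Theorem theorem3p1 (R : realType) (L : ngraph)
    (L_row_finite : row_finite L) (L_no_sources : no_sources L)
    (A : cstarAlgType R) (s : gpath L -> A) (sA : is_graph_algebra s)
    (alpha : torus R -> {linear A -> A}) (alphaP : gauge_action s alpha)
    (B : cstarAlgType R) (f : {linear A -> B}) (f_star : star_hom f)
    (beta : torus R -> {linear B -> B}) (betaP : torus_action beta)
    (f_equivariant : forall t (a : A), f (alpha t a) = beta t (f a)) :
  injective f <-> (forall v : vertex L, f (s (gid v)) <> 0).
Proof.
have [sP s_gen _] := sA; split=> [f_inj v fv0|f_vertex].
  apply: (graph_algebra_vertex_neq0 (v := v) L_row_finite L_no_sources sA).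
  by apply: f_inj; rewrite fv0 linear0.
exact: (gauge_invariant_uniqueness L_row_finite sP alphaP f_star betaP).
Qed.
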